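(* Let $(H,R)$ be a quasitriangular quasi-bialgebra over a field $k$, with associator $\Phi=\sum X^1\otimes X^2\otimes X^3=\sum Y^1\otimes Y^2\otimes Y^3$, with $R=\sum R^1\otimes R^2$ and $R^{-1}=U=\sum U^1\otimes U^2$. Let $H^*_R$ be the vector space $H^*=\mathrm{Hom}_k(H,k)$ equipped with the (in general non-associative) product $f\cdot g=\sum (R^2\rightharpoonup g)(R^1\rightharpoonup f)$, i.e. $(f\cdot g)(h)=\sum g(h_1R^2)f(h_2R^1)$ for $h\in H$. Then: a) $H^*_R$ is an algebra in the tensor category $H_{lr}$, that is, for all $f,g,l\in H^*$ and $h,h'\in H$: $$h\rightharpoonup (f\cdot g)\leftharpoonup h'=\sum (h_1\rightharpoonup f\leftharpoonup h'_2)\cdot (h_2\rightharpoonup g\leftharpoonup h'_1),$$ $$(f\cdot g)\cdot l=\sum (X^1\rightharpoonup f\leftharpoonup Y^3)\cdot ((X^2\rightharpoonup g\leftharpoonup Y^2)\cdot (X^3\rightharpoonup l\leftharpoonup Y^1)),$$ $$\varepsilon \cdot f=f\cdot \varepsilon=f,$$ $$h\rightharpoonup \varepsilon\leftharpoonup h'=\varepsilon (h)\varepsilon (h')\varepsilon .$$ b) $H^*_R$ is quantum commutative as an algebra in the braided tensor category $H_{lr}$, that is, for all $f,g\in H^*$, $$f\cdot g =\sum (R^2\rightharpoonup g\leftharpoonup U^1)\cdot (R^1\rightharpoonup f\leftharpoonup U^2).$$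
   Context: All objects are over a field $k$, $\otimes=\otimes_k$, $I$ is the identity map, and $\Delta(h)=\sum h_1\otimes h_2$. Quasi-bialgebra: an associative unital algebra $H$ with algebra homomorphisms $\Delta:H\to H\otimes H$, $\varepsilon:H\to k$ and an invertible $\Phi\in H^{\otimes 3}$ (the associator) such that for all $h\in H$: $(I\otimes\Delta)(\Delta(h))=\Phi\,(\Delta\otimes I)(\Delta(h))\,\Phi^{-1}$; $(\varepsilon\otimes I)(\Delta(h))=h=(I\otimes\varepsilon)(\Delta(h))$; $(I\otimes I\otimes\Delta)(\Phi)(\Delta\otimes I\otimes I)(\Phi)=(1\otimes\Phi)(I\otimes\Delta\otimes I)(\Phi)(\Phi\otimes 1)$; $(I\otimes\varepsilon\otimes I)(\Phi)=1\otimes 1$. Quasitriangular: there is given an invertible $R\in H\otimes H$ with $(\Delta\otimes I)(R)=\Phi_{312}R_{13}\Phi^{-1}_{132}R_{23}\Phi$, $(I\otimes\Delta)(R)=\Phi^{-1}_{231}R_{13}\Phi_{213}R_{12}\Phi^{-1}$, and $\Delta^{cop}(h)=R\Delta(h)R^{-1}$ for all $h\in H$, where $\Delta^{cop}(h)=\sum h_2\otimes h_1$. Here for a permutation $t$ of $\{1,2,3\}$, $\Phi_{t(1)t(2)t(3)}=\sum X^{t^{-1}(1)}\otimes X^{t^{-1}(2)}\otimes X^{t^{-1}(3)}$ (similarly for $\Phi^{-1}$), and $R_{ij}$ is $R$ placed in tensor positions $i,j$ of $H^{\otimes 3}$. Regular actions of $H$ on $H^*$: $(h\rightharpoonup p)(h')=p(h'h)$,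 $(p\leftharpoonup h)(h')=p(hh')$; they make $H^*$ an $H$-bimodule. Juxtaposition $fg$ in $H^*$ is convolution, $(fg)(h)=\sum f(h_1)g(h_2)$. $H_{lr}$ is the category of $H$-bimodules with tensor product $V\otimes W$ having actions $h\cdot(v\otimes w)\cdot h'=\sum h_1\cdot v\cdot h'_2\otimes h_2\cdot w\cdot h'_1$, associativity constraint $(u\otimes v)\otimes w\mapsto\sum X^1\cdot u\cdot Y^3\otimes(X^2\cdot v\cdot Y^2\otimes X^3\cdot w\cdot Y^1)$, usual unit constraints, and braiding $c_{V,W}(v\otimes w)=\sum R^2\cdot w\cdot U^1\otimes R^1\cdot v\cdot U^2$. An algebra $B$ with multiplication $m_B$ in a braided tensor category with braiding $c$ is quantum commutative if $m_B\circ c_{B,B}=m_B$. *)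

(* Defs.v *)
From HB Require Import structures.
From mathcomp Require Import all_boot all_order all_algebra generic_quotient.
From mathcomp Require Import boolp classical_sets.

Set Implicit Arguments.
Unset Strict Implicit.
Unset Printing Implicit Defensive.

Import GRing.Theory.
Local Open Scope ring_scope.
Local Open Scope quotient_scope.

Reserved Notation "x ⊗ y" (at level 38, right associativity).
Reserved Notation "'\tsum_' ( u ⊗ v <- t ) E"
  (at level 41, E at level 41, u name, v name, t at level 60,
   format "'[' '\tsum_' ( u  ⊗  v  <-  t ) '/  '  E ']'").
Reserved Notation "'\tsum_' ( u ⊗ v ⊗ w <- t ) E"
  (at level 41, E at level 41, u name, v name, w name, t at level 60,
   format "'[' '\tsum_' ( u  ⊗  v  ⊗  w  <-  t ) '/  '  E ']'").
Reserved Notation "f · g" (at level 40, left associativity).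
Reserved Notation "h ⇀ v" (at level 39, left associativity).
Reserved Notation "v ↼ h" (at level 39, left associativity).

Section Tensor.
Variables (k : fieldType) (U V : lmodType k).

(* A list of pairs stands for the formal sum of its pairs, so [tensor] is the *)
(* free commutative monoid on [U * V] modulo the usual relations; it is a     *)
(* group because [(-1 *: u, v)] is an opposite of [(u, v)].                   *)
Inductive tens_eq : seq (U * V) -> seq (U * V) -> Prop :=
| TensRefl s : tens_eq s s
| TensSym s t : tens_eq s t -> tens_eq t s
| TensTrans s t r : tens_eq s t -> tens_eq t r -> tens_eq s r
| TensCat s s' t t' :
    tens_eq s s' -> tens_eq t t' -> tens_eq (s ++ t) (s' ++ t')
| TensComm s t : tens_eq (s ++ t) (t ++ s)
| TensAddl u u' v : tens_eq [:: (u + u', v)] [:: (u, v); (u', v)]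
| TensAddr u v v' : tens_eq [:: (u, v + v')] [:: (u, v); (u, v')]
| TensScale a u v : tens_eq [:: (a *: u, v)] [:: (u, a *: v)]
| TensZero v : tens_eq [:: (0, v)] [::].

Definition tens_eqb (s t : seq (U * V)) : bool := `[< tens_eq s t >].

Fact tens_eqb_refl : reflexive tens_eqb.
Proof. by move=> s; apply/asboolP/TensRefl. Qed.

Fact tens_eqb_sym : symmetric tens_eqb.
Proof. by move=> s t; apply/asboolP/asboolP => /TensSym. Qed.

Fact tens_eqb_trans : transitive tens_eqb.
Proof.
by move=> t s r /asboolP st /asboolP tr; apply/asboolP/(TensTrans st tr).
Qed.

Canonical tens_equiv :=
  EquivRel tens_eqb tens_eqb_refl tens_eqb_sym tens_eqb_trans.

Definition tensor : Type := {eq_quot tens_equiv}.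

HB.instance Definition _ := Choice.on tensor.
HB.instance Definition _ := EqQuotient.on tensor.

Let cls (s : seq (U * V)) : tensor := \pi_tensor s.

Let clsP s t : tens_eq s t -> cls s = cls t.
Proof. by move=> st; apply/eqmodP/asboolP. Qed.

Let clsE s t : cls s = cls t -> tens_eq s t.
Proof. by move/eqmodP/asboolP. Qed.

Let clsK (x : tensor) : cls (repr x) = x. Proof. exact: reprK. Qed.

Let reprcls s : tens_eq (repr (cls s)) s. Proof. by apply/clsE; rewrite clsK. Qed.

Definition tens (u : U) (v : V) : tensor := cls [:: (u, v)].

Definition tens_zero : tensor := cls [::].
Definition tens_add (x y : tensor) : tensor := cls (repr x ++ repr y).
Definition tens_scale (a : k) (x : tensor) : tensor :=
  cls [seq (a *: p.1, p.2) | p <- repr x].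
Definition tens_opp : tensor -> tensor := tens_scale (-1).

Let scl (a : k) (s : seq (U * V)) := [seq (a *: p.1, p.2) | p <- s].

Let add_cls s t : tens_add (cls s) (cls t) = cls (s ++ t).
Proof. by apply/clsP/TensCat; apply/reprcls. Qed.

Let scl_eq a s t : tens_eq s t -> tens_eq (scl a s) (scl a t).
Proof.
elim=> {s t}.
- by move=> s; apply: TensRefl.
- by move=> s t _; apply: TensSym.
- by move=> s t r _ IH1 _; apply: TensTrans.
- by move=> s s' t t' _ IH1 _ IH2; rewrite /scl !map_cat; apply: TensCat.
- by move=> s t; rewrite /scl !map_cat; apply: TensComm.
- by move=> u u' v /=; rewrite scalerDr; apply: TensAddl.
- by move=> u v v' /=; apply: TensAddr.
- move=> b u v /=; rewrite scalerA mulrC -scalerA; exact: TensScale.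
- by move=> v /=; rewrite scaler0; apply: TensZero.
Qed.

Let scale_cls a s : tens_scale a (cls s) = cls (scl a s).
Proof. by apply/clsP/scl_eq/reprcls. Qed.

Fact tens_addA : associative tens_add.
Proof.
by move=> x y z; rewrite -[x]clsK -[y]clsK -[z]clsK !add_cls catA.
Qed.

Fact tens_addC : commutative tens_add.
Proof.
move=> x y; rewrite -[x]clsK -[y]clsK !add_cls; exact/clsP/TensComm.
Qed.

Fact tens_add0 : left_id tens_zero tens_add.
Proof. by move=> x; rewrite -[x]clsK add_cls. Qed.

Let cls_cons p s : cls (p :: s) = tens_add (cls [:: p]) (cls s).
Proof. by rewrite add_cls. Qed.

Fact tens_scaleDr a : {morph tens_scale a : x y / tens_add x y}.
Proof.
move=> x y; rewrite -[x]clsK -[y]clsK add_cls !scale_cls add_cls.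
by rewrite /scl map_cat.
Qed.

Let tens_add4 x y z t : tens_add (tens_add x y) (tens_add z t) =
  tens_add (tens_add x z) (tens_add y t).
Proof.
rewrite !tens_addA; congr tens_add.
by rewrite -!tens_addA [tens_add z y]tens_addC.
Qed.

Fact tens_scaleDl x a b :
  tens_scale (a + b) x = tens_add (tens_scale a x) (tens_scale b x).
Proof.
rewrite -[x]clsK !scale_cls; elim: (repr x) => [|p s IH] /=.
  by rewrite add_cls.
rewrite cls_cons IH [cls ((a *: _, _) :: _)]cls_cons.
rewrite [cls ((b *: _, _) :: _)]cls_cons tens_add4; congr tens_add.
by rewrite add_cls scalerDl; exact/clsP/TensAddl.
Qed.

Fact tens_scale0 x : tens_scale 0 x = tens_zero.
Proof.
rewrite -[x]clsK scale_cls; elim: (repr x) => [|p s IH] //=.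
rewrite cls_cons IH scale0r; suff -> : cls [:: (0, p.2)] = tens_zero.
  exact: tens_add0.
exact/clsP/TensZero.
Qed.

Fact tens_scale1 : left_id 1 tens_scale.
Proof.
move=> x; rewrite -[RHS]clsK -[in LHS](clsK x) scale_cls; congr cls.
by rewrite -[RHS]map_id; apply: eq_map => -[u v] /=; rewrite scale1r.
Qed.

Fact tens_scaleA a b x : tens_scale a (tens_scale b x) = tens_scale (a * b) x.
Proof.
rewrite -[x]clsK !scale_cls; congr cls; rewrite /scl -map_comp.
by apply: eq_map => -[u v] /=; rewrite scalerA.
Qed.

Fact tens_addN : left_inverse tens_zero tens_opp tens_add.
Proof.
move=> x; rewrite -[X in tens_add _ X]tens_scale1 /tens_opp -tens_scaleDl.
by rewrite addNr tens_scale0.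
Qed.

HB.instance Definition _ :=
  GRing.isZmodule.Build tensor tens_addA tens_addC tens_add0 tens_addN.

HB.instance Definition _ := GRing.Zmodule_isLmodule.Build k tensor
  tens_scaleA tens_scale1 tens_scaleDr tens_scaleDl.

Fact repr_tens u v : tens_eq (repr (tens u v)) [:: (u, v)].
Proof. exact: reprcls. Qed.

Fact repr_tensD (x y : tensor) : tens_eq (repr (x + y)) (repr x ++ repr y).
Proof. exact: reprcls. Qed.

Fact repr_tensZ a (x : tensor) :
  tens_eq (repr (a *: x)) [seq (a *: p.1, p.2) | p <- repr x].
Proof. exact: reprcls. Qed.

Lemma tensDl u u' v : tens (u + u') v = tens u v + tens u' v.
Proof. by rewrite [RHS]add_cls; apply/clsP/TensAddl. Qed.

Lemma tensDr u v v' : tens u (v + v') = tens u v + tens u v'.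
Proof. by rewrite [RHS]add_cls; apply/clsP/TensAddr. Qed.

Lemma tensZl a u v : tens (a *: u) v = a *: tens u v.
Proof. by rewrite [RHS]scale_cls. Qed.

Lemma tensZr a u v : tens u (a *: v) = a *: tens u v.
Proof. by rewrite -tensZl; apply: esym; exact/clsP/TensScale. Qed.

Lemma tens_ind (P : tensor -> Prop) :
  P 0 -> (forall u v, P (tens u v)) ->
  (forall x y, P x -> P y -> P (x + y)) -> forall x, P x.
Proof.
move=> P0 Pt PD x; rewrite -[x]clsK; elim: (repr x) => [|[u v] s IH].
  exact: P0.
by rewrite cls_cons; apply: PD IH; apply: Pt.
Qed.

End Tensor.

Arguments tensor {k} (U V)%_type.

Notation "U ⊗ V" := (tensor U V) : type_scope.
Notation "u ⊗ v" := (tens u v) : ring_scope.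

Section LinearFacts.
Variables (k : fieldType) (X Y : lmodType k) (g : X -> Y).
Hypothesis gl : linear g.

Lemma lin0 : g 0 = 0.
Proof. by have := gl (-1) 0 0; rewrite scaler0 addr0 scaleN1r addNr. Qed.

Lemma linD : {morph g : x y / x + y}.
Proof. by move=> x y; have := gl 1 x y; rewrite !scale1r. Qed.

Lemma linZ a x : g (a *: x) = a *: g x.
Proof. by have := gl a x 0; rewrite addr0 lin0 addr0. Qed.

End LinearFacts.

Section Lift.
Variables (k : fieldType) (U V W : lmodType k).

Definition bilin (f : U -> V -> W) : Prop :=
  (forall v, linear (f ^~ v)) /\ (forall u, linear (f u)).

(* Universal property: for a bilinear [f] this is the linear map sending      *)
(* [u ⊗ v] to [f u v]; for other [f] the value depends on the representative. *)
Definition tlift (f : U -> V -> W) (t : U ⊗ V) : W :=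
  \sum_(p <- repr t) f p.1 p.2.

Let tlift_eq f s t : bilin f -> tens_eq s t ->
  \sum_(p <- s) f p.1 p.2 = \sum_(p <- t) f p.1 p.2.
Proof.
case=> fl fr; elim=> {s t} //.
- by move=> s t r _ -> _ ->.
- by move=> s s' t t' _ IH1 _ IH2; rewrite !big_cat IH1 IH2.
- by move=> s t; rewrite !big_cat /= addrC.
- by move=> u u' v; rewrite !big_cons big_nil !addr0 (linD (fl v)).
- by move=> u v v'; rewrite !big_cons big_nil !addr0 (linD (fr u)).
- by move=> a u v; rewrite !big_seq1 (linZ (fl v)) (linZ (fr u)).
- by move=> v; rewrite big_seq1 big_nil (lin0 (fl v)).
Qed.

Lemma tlift_tens f u v : bilin f -> tlift f (u ⊗ v) = f u v.
Proof. by move=> fb; rewrite /tlift (tlift_eq fb (repr_tens u v)) big_seq1. Qed.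

Lemma tlift_linear f : bilin f -> linear (tlift f).
Proof.
move=> fb a x y; rewrite /tlift (tlift_eq fb (repr_tensD _ _)) big_cat.
rewrite (tlift_eq fb (repr_tensZ _ _)) big_map scaler_sumr; congr (_ + _).
by apply: eq_bigr => p _ /=; rewrite (linZ (fb.1 p.2)).
Qed.

Lemma eq_tlift f g : (forall u v, f u v = g u v) -> tlift f =1 tlift g.
Proof. by move=> fg t; apply: eq_bigr => p _. Qed.

Lemma tlift_param (X : lmodType k) (F : X -> U -> V -> W) t :
  (forall u v, linear (fun x => F x u v)) -> linear (fun x => tlift (F x) t).
Proof.
move=> Fl a x y; rewrite /tlift scaler_sumr -big_split /=.
by apply: eq_bigr => p _; rewrite Fl.
Qed.

Lemma tens_ext (g h : U ⊗ V -> W) : linear g -> linear h ->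
  (forall u v, g (u ⊗ v) = h (u ⊗ v)) -> g =1 h.
Proof.
move=> gl hl gh; apply: tens_ind => [|//|x y gx gy].
  by rewrite (lin0 gl) (lin0 hl).
by rewrite (linD gl) (linD hl) gx gy.
Qed.

End Lift.

Notation "'\tsum_' ( u ⊗ v <- t ) E" := (tlift (fun u v => E) t) : ring_scope.
Notation "'\tsum_' ( u ⊗ v ⊗ w <- t ) E" :=
  (tlift (fun u => tlift (fun v w => E)) t) : ring_scope.

Lemma bilin_tens (k : fieldType) (U V : lmodType k) : bilin (@tens k U V).
Proof. by split=> [v|u] a x y; rewrite ?tensDl ?tensDr ?tensZl ?tensZr. Qed.

Definition tmap (k : fieldType) (U V U' V' : lmodType k)
    (f : U -> U') (g : V -> V') (t : U ⊗ V) : U' ⊗ V' :=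
  \tsum_(u ⊗ v <- t) f u ⊗ g v.

Section TmapTheory.
Variables (k : fieldType) (U V U' V' : lmodType k).
Variables (f : U -> U') (g : V -> V').
Hypotheses (fl : linear f) (gl : linear g).

Let tmap_bilin : bilin (fun u v => f u ⊗ g v).
Proof.
split=> [v|u] a x y; first by rewrite fl tensDl tensZl.
by rewrite gl tensDr tensZr.
Qed.

Lemma tmap_tens u v : tmap f g (u ⊗ v) = f u ⊗ g v.
Proof. exact: tlift_tens. Qed.

Lemma tmap_linear : linear (tmap f g).
Proof. exact: tlift_linear. Qed.

End TmapTheory.

Definition tassoc (k : fieldType) (U V W : lmodType k)
    (t : (U ⊗ V) ⊗ W) : U ⊗ V ⊗ W :=
  \tsum_(s ⊗ w <- t) \tsum_(u ⊗ v <- s) u ⊗ v ⊗ w.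

Section NonzeroFunctional.
Variables (k : fieldType) (A : lmodType k) (e : A).
Hypothesis e_neq0 : e != 0.

Lemma exists_functional : exists2 f : A -> k^o, linear f & f e = 1.
Proof.
pose P (W : set A) := (forall a u v, W u -> W v -> W (a *: u + v)) /\ ~ W e.
have [F FP Ftot|W [[Wlin We] Wmax]] := @Zorn_bigcup A P.
  split=> [a u v [X FX Xu] [Y FY Yv]|[X /FP[] _ XP]//].
  have [XY|YX] := Ftot _ _ FX FY.
    by exists Y => //; apply: (FP Y FY).1 => //; apply: XY.
  by exists X => //; apply: (FP X FX).1 => //; apply: YX.
have W0 : W 0.
  apply: contrapT => nW0; apply: (Wmax (W `|` [set 0])%classic).
    by split=> [x|/(_ 0)]; [left | move=> /(_ (or_intror erefl))].
  split=> [a u v [Wu|->] [Wv|->]|[//|/eqP]]; last by rewrite (negbTE e_neq0).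
  - by left; apply: Wlin.
  - left; rewrite addr0; suff : W ((a - 1) *: u + u).
      by rewrite scalerBl scale1r subrK.
    exact: Wlin.
  - by left; rewrite scaler0 add0r.
  - by right; rewrite scaler0 addr0.
have WZ a u : W u -> W (a *: u) by move=> /(Wlin a u 0)/(_ W0); rewrite addr0.
have WD u v : W u -> W v -> W (u + v) by move=> /(Wlin 1 u v); rewrite scale1r.
have WB u v : W u -> W v -> W (u - v).
  by move=> Wu Wv; rewrite -scaleN1r; apply/WD/WZ.
have dec x : exists d : k, W (x - d *: e).
  have [Wx|nWx] := pselect (W x); first by exists 0; rewrite scale0r subr0.
  pose W' : set A := fun z => exists2 c : k, True & W (z - c *: x).
  have : ~ P W'.
    apply: Wmax; split=> [z Wz|/(_ x)]; first by exists 0; rewrite // scale0r subr0.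
    by move=> W'x; apply/nWx/W'x; exists 1; rewrite // scale1r subrr.
  move/not_andP => [|/contrapT[c _ Wc]].
    case=> a u v [c _ Wu] [d _ Wv]; exists (a * c + d) => //.
    rewrite scalerDl -scalerA opprD addrACA -scalerBr; exact: Wlin.
  have [c0|c_neq0] := eqVneq c 0; first by move: Wc; rewrite c0 scale0r subr0.
  exists c^-1; have := WZ (- c^-1) _ Wc; rewrite scalerBr scalerA mulNr.
  by rewrite mulVf // scaleN1r scaleNr opprK addrC.
have [f fP] := choice dec.
have uni x d : W (x - d *: e) -> f x = d.
  move=> Wd; apply/eqP; case: eqVneq => // ; rewrite -subr_eq0 => nz; case: We.
  have := WZ (f x - d)^-1 _ (WB _ _ Wd (fP x)).
  rewrite [x - _ - _]addrC opprB addrA subrK -scalerBl scalerA mulVf //.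
  by rewrite scale1r.
exists f; last by apply: uni; rewrite scale1r subrr.
move=> a x y; apply: uni; rewrite scalerDl.
rewrite -scalerA opprD addrACA -scalerBr; exact: Wlin.
Qed.

End NonzeroFunctional.

Section TensorAlgebra.
Variables (k : fieldType) (A B : algType k).

Definition tens_mul (s t : A ⊗ B) : A ⊗ B :=
  \tsum_(a ⊗ b <- s) \tsum_(c ⊗ d <- t) (a * c) ⊗ (b * d).

Let bilin_in a b : bilin (fun (c : A) (d : B) => (a * c) ⊗ (b * d)).
Proof.
split=> [d|c] x y z.
  by rewrite mulrDr -scalerAr tensDl tensZl.
by rewrite mulrDr -scalerAr tensDr tensZr.
Qed.

Let bilin_out t :
  bilin (fun (a : A) (b : B) => \tsum_(c ⊗ d <- t) (a * c) ⊗ (b * d)).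
Proof.
split=> [b|a]; apply: tlift_param => c d x y z.
  by rewrite mulrDl -scalerAl tensDl tensZl.
by rewrite mulrDl -scalerAl tensDr tensZr.
Qed.

Let mulE a b c d : tens_mul (a ⊗ b) (c ⊗ d) = (a * c) ⊗ (b * d).
Proof. by rewrite /tens_mul tlift_tens // tlift_tens. Qed.

Let mull t : linear (tens_mul^~ t).
Proof. exact: tlift_linear. Qed.

Let mulr s : linear (tens_mul s).
Proof.
by apply: tlift_param => a b; exact: tlift_linear.
Qed.

Fact tens_mulA : associative tens_mul.
Proof.
move=> x y z; move: x; apply: tens_ext => [||a b].
- exact: mull.
- by move=> c x x'; rewrite (mull y) (mull z).
move: y; apply: tens_ext => [||c d].
- by move=> e y y'; rewrite (mull z) (mulr (a ⊗ b)).
- by move=> e y y'; rewrite (mulr (a ⊗ b)) (mull z).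
move: z; apply: tens_ext => [||e f].
- by move=> g z z'; rewrite (mulr (c ⊗ d)) (mulr (a ⊗ b)).
- exact: mulr.
by rewrite !mulE !mulrA.
Qed.

Fact tens_mul1 : left_id (1 ⊗ 1) tens_mul.
Proof.
by apply: tens_ext => [||a b]; [exact: mulr | | rewrite mulE !mul1r].
Qed.

Fact tens_mulr1 : right_id (1 ⊗ 1) tens_mul.
Proof.
by apply: tens_ext => [||a b]; [exact: mull | | rewrite mulE !mulr1].
Qed.

Fact tens_mulDl : left_distributive tens_mul +%R.
Proof. by move=> x y z; rewrite (linD (mull z)). Qed.

Fact tens_mulDr : right_distributive tens_mul +%R.
Proof. by move=> x y z; rewrite (linD (mulr x)). Qed.

Fact tens_one_neq0 : (1 : A) ⊗ (1 : B) != 0.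
Proof.
have [f fl f1] := exists_functional (oner_neq0 A).
have [g gl g1] := exists_functional (oner_neq0 B).
have fgb : bilin (fun (a : A) (b : B) => f a * g b : k^o).
  split=> [b|a] c x y.
    by rewrite fl mulrDl -scalerAl.
  by rewrite gl mulrDr -scalerAr.
apply/eqP => /(congr1 (tlift (fun a b => f a * g b : k^o))).
rewrite tlift_tens // f1 g1 mulr1 (lin0 (tlift_linear fgb)).
exact/eqP/oner_neq0.
Qed.

HB.instance Definition _ := GRing.Zmodule_isNzRing.Build (A ⊗ B)%type
  tens_mulA tens_mul1 tens_mulr1 tens_mulDl tens_mulDr tens_one_neq0.

Fact tens_scaleAl (a : k) (x y : A ⊗ B) : a *: (x * y) = (a *: x) * y.
Proof. exact/esym/(linZ (mull y)). Qed.

HB.instance Definition _ :=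
  GRing.Lmodule_isLalgebra.Build k (A ⊗ B)%type tens_scaleAl.

Fact tens_scaleAr (a : k) (x y : A ⊗ B) : a *: (x * y) = x * (a *: y).
Proof. exact/esym/(linZ (mulr x)). Qed.

HB.instance Definition _ :=
  GRing.Lalgebra_isAlgebra.Build k (A ⊗ B)%type tens_scaleAr.

Lemma tensM (a c : A) (b d : B) : (a ⊗ b) * (c ⊗ d) = (a * c) ⊗ (b * d).
Proof. exact: mulE. Qed.

Lemma tens1E : 1 = 1 ⊗ 1 :> A ⊗ B. Proof. by []. Qed.

End TensorAlgebra.

Section Dual.
Variables (k : fieldType) (V : lmodType k).

Definition dual : Type := {scalar V}.

HB.instance Definition _ := gen_eqMixin dual.
HB.instance Definition _ := gen_choiceMixin dual.

Definition mkdual (f : V -> k) (fl : scalar f) : dual :=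
  HB.pack f (GRing.isLinear.Build k V k *%R f fl).

Lemma dual_ext (f g : dual) : f =1 g -> f = g.
Proof.
case: f g => [f [[[f0 fD]] [fZ]]] [g [[[g0 gD]] [gZ]]] /= /funext fg.
move: f0 fD fZ; rewrite fg => f0 fD fZ.
by rewrite (Prop_irrelevance f0 g0) (Prop_irrelevance fD gD)
  (Prop_irrelevance fZ gZ).
Qed.

Fact dual_zero_scalar : scalar (fun _ : V => 0 : k).
Proof. by move=> a x y; rewrite mulr0 addr0. Qed.

Fact dual_add_scalar (f g : dual) : scalar (fun x => f x + g x).
Proof. by move=> a x y; rewrite !linearP mulrDr addrACA. Qed.

Fact dual_scale_scalar (a : k) (f : dual) : scalar (fun x => a * f x).
Proof. by move=> b x y; rewrite linearP mulrDr mulrCA. Qed.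

Definition dual_zero : dual := mkdual dual_zero_scalar.
Definition dual_add (f g : dual) : dual := mkdual (dual_add_scalar f g).
Definition dual_scale (a : k) (f : dual) : dual :=
  mkdual (dual_scale_scalar a f).

Fact dual_addA : associative dual_add.
Proof. by move=> f g h; apply: dual_ext => x /=; rewrite addrA. Qed.

Fact dual_addC : commutative dual_add.
Proof. by move=> f g; apply: dual_ext => x /=; rewrite addrC. Qed.

Fact dual_add0 : left_id dual_zero dual_add.
Proof. by move=> f; apply: dual_ext => x /=; rewrite add0r. Qed.

Fact dual_addN : left_inverse dual_zero (dual_scale (-1)) dual_add.
Proof. by move=> f; apply: dual_ext => x /=; rewrite mulN1r addNr. Qed.

HB.instance Definition _ :=
  GRing.isZmodule.Build dual dual_addA dual_addC dual_add0 dual_addN.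

Fact dual_scaleA a b f : dual_scale a (dual_scale b f) = dual_scale (a * b) f.
Proof. by apply: dual_ext => x /=; rewrite mulrA. Qed.

Fact dual_scale1 : left_id 1 dual_scale.
Proof. by move=> f; apply: dual_ext => x /=; rewrite mul1r. Qed.

Fact dual_scaleDr : right_distributive dual_scale +%R.
Proof. by move=> a f g; apply: dual_ext => x /=; rewrite mulrDr. Qed.

Fact dual_scaleDl f : {morph dual_scale^~ f : a b / a + b}.
Proof. by move=> a b; apply: dual_ext => x /=; rewrite mulrDl. Qed.

HB.instance Definition _ := GRing.Zmodule_isLmodule.Build k dual
  dual_scaleA dual_scale1 dual_scaleDr dual_scaleDl.

Lemma dual0E x : (0 : dual) x = 0. Proof. by []. Qed.
Lemma dualDE (f g : dual) x : (f + g) x = f x + g x. Proof. by []. Qed.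
Lemma dualZE a (f : dual) x : (a *: f) x = a * f x. Proof. by []. Qed.

Lemma dual_sumE (I : Type) (r : seq I) (F : I -> dual) x :
  (\sum_(i <- r) F i) x = \sum_(i <- r) F i x.
Proof. by elim/big_rec2: _ => // i y f _ <-. Qed.

End Dual.

HB.mixin Record isBimodule (k : fieldType) (H : algType k) V
    of GRing.Lmodule k V := {
  lact : H -> V -> V;
  ract : V -> H -> V;
  lact_bilin : bilin lact;
  ract_bilin : bilin ract;
  lact1 : forall v, lact 1 v = v;
  ract1 : forall v, ract v 1 = v;
  lactM : forall h h' v, lact (h * h') v = lact h (lact h' v);
  ractM : forall h h' v, ract v (h * h') = ract (ract v h) h';
  lract : forall h h' v, ract (lact h v) h' = lact h (ract v h')
}.

#[short(type="bimodType")]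
HB.structure Definition Bimodule (k : fieldType) (H : algType k) :=
  {V of GRing.Lmodule k V & isBimodule k H V}.

Notation "h ⇀ v" := (lact h v) : ring_scope.
Notation "v ↼ h" := (ract v h) : ring_scope.

Section RegularActions.
Variables (k : fieldType) (H : algType k).

Fact reg_lact_scalar (h : H) (p : dual H) : scalar (fun x => p (x * h)).
Proof. by move=> a x y; rewrite mulrDl -scalerAl linearP. Qed.

Fact reg_ract_scalar (p : dual H) (h : H) : scalar (fun x => p (h * x)).
Proof. by move=> a x y; rewrite mulrDr -scalerAr linearP. Qed.

Definition reg_lact (h : H) (p : dual H) : dual H := mkdual (reg_lact_scalar h p).
Definition reg_ract (p : dual H) (h : H) : dual H := mkdual (reg_ract_scalar p h).

Fact reg_lact_bilin : bilin reg_lact.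
Proof.
split=> [p|h] a x y; apply: dual_ext => z //=.
by rewrite mulrDr -scalerAr linearP.
Qed.

Fact reg_ract_bilin : bilin reg_ract.
Proof.
split=> [h|p] a x y; apply: dual_ext => z //=.
by rewrite mulrDl -scalerAl linearP.
Qed.

Fact reg_lact1 p : reg_lact 1 p = p.
Proof. by apply: dual_ext => x /=; rewrite mulr1. Qed.

Fact reg_ract1 p : reg_ract p 1 = p.
Proof. by apply: dual_ext => x /=; rewrite mul1r. Qed.

Fact reg_lactM h h' p : reg_lact (h * h') p = reg_lact h (reg_lact h' p).
Proof. by apply: dual_ext => x /=; rewrite mulrA. Qed.

Fact reg_ractM h h' p : reg_ract p (h * h') = reg_ract (reg_ract p h) h'.
Proof. by apply: dual_ext => x /=; rewrite mulrA. Qed.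

Fact reg_lract h h' p : reg_ract (reg_lact h p) h' = reg_lact h (reg_ract p h').
Proof. by apply: dual_ext => x /=; rewrite mulrA. Qed.

HB.instance Definition _ := isBimodule.Build k H (dual H)
  reg_lact_bilin reg_ract_bilin reg_lact1 reg_ract1
  reg_lactM reg_ractM reg_lract.

End RegularActions.

(* Iterated tensor products are bracketed to the right, [tassoc] moving       *)
(* brackets where needed, and [k ⊗ V] and [V ⊗ k] are identified with [V].    *)
Record quasiBialgebra (k : fieldType) := QuasiBialgebra {
  qb_alg :> algType k;
  Delta : {lrmorphism qb_alg -> qb_alg ⊗ qb_alg};
  counit : {lrmorphism qb_alg -> k | *%R};
  Phi : qb_alg ⊗ qb_alg ⊗ qb_alg;
  PhiV : qb_alg ⊗ qb_alg ⊗ qb_alg;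
  mulPhiV : Phi * PhiV = 1;
  mulVPhi : PhiV * Phi = 1;
  quasi_coassoc : forall h,
    tmap id Delta (Delta h) = Phi * tassoc (tmap Delta id (Delta h)) * PhiV;
  counit_l : forall h, \tsum_(h1 ⊗ h2 <- Delta h) counit h1 *: h2 = h;
  counit_r : forall h, \tsum_(h1 ⊗ h2 <- Delta h) counit h2 *: h1 = h;
  pentagon :
    tmap id (tmap id Delta) Phi * tassoc (tmap Delta id Phi) =
    (1 ⊗ Phi) * tmap id (fun t => tassoc (tmap Delta id t)) Phi
      * tmap id (@tassoc _ _ _ _) (tassoc (Phi ⊗ 1));
  Phi_counit : \tsum_(x1 ⊗ x2 ⊗ x3 <- Phi) counit x2 *: (x1 ⊗ x3) = 1
}.

Section Legs.
Variables (k : fieldType) (A : algType k).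
Implicit Types (t : A ⊗ A ⊗ A) (r : A ⊗ A).

(* [leg_abc t] has the first leg of [t] in position [a], the second in        *)
(* position [b] and the third in position [c].                                *)
Definition leg_132 t : A ⊗ A ⊗ A := \tsum_(x1 ⊗ x2 ⊗ x3 <- t) x1 ⊗ x3 ⊗ x2.
Definition leg_213 t : A ⊗ A ⊗ A := \tsum_(x1 ⊗ x2 ⊗ x3 <- t) x2 ⊗ x1 ⊗ x3.
Definition leg_231 t : A ⊗ A ⊗ A := \tsum_(x1 ⊗ x2 ⊗ x3 <- t) x3 ⊗ x1 ⊗ x2.
Definition leg_312 t : A ⊗ A ⊗ A := \tsum_(x1 ⊗ x2 ⊗ x3 <- t) x2 ⊗ x3 ⊗ x1.

Definition leg_12 r : A ⊗ A ⊗ A := \tsum_(r1 ⊗ r2 <- r) r1 ⊗ r2 ⊗ 1.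
Definition leg_13 r : A ⊗ A ⊗ A := \tsum_(r1 ⊗ r2 <- r) r1 ⊗ 1 ⊗ r2.
Definition leg_23 r : A ⊗ A ⊗ A := \tsum_(r1 ⊗ r2 <- r) 1 ⊗ r1 ⊗ r2.

Definition tflip r : A ⊗ A := \tsum_(r1 ⊗ r2 <- r) r2 ⊗ r1.

End Legs.

Record quasitriangular (k : fieldType) := Quasitriangular {
  qt_qb :> quasiBialgebra k;
  Rmx : qt_qb ⊗ qt_qb;
  RmxV : qt_qb ⊗ qt_qb;
  mulRV : Rmx * RmxV = 1;
  mulVR : RmxV * Rmx = 1;
  Delta_id_R :
    tassoc (tmap (Delta qt_qb) id Rmx) =
    leg_312 (Phi qt_qb) * leg_13 Rmx * leg_132 (PhiV qt_qb) * leg_23 Rmx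
      * Phi qt_qb;
  id_Delta_R :
    tmap id (Delta qt_qb) Rmx =
    leg_231 (PhiV qt_qb) * leg_13 Rmx * leg_213 (Phi qt_qb) * leg_12 Rmx
      * PhiV qt_qb;
  Delta_cop : forall h, tflip (Delta qt_qb h) = Rmx * Delta qt_qb h * RmxV
}.

Section TensorBimodule.
Variables (k : fieldType) (H : quasiBialgebra k) (V W : bimodType H).

Let tl (s : H ⊗ H) (t : V ⊗ W) : V ⊗ W :=
  \tsum_(h1 ⊗ h2 <- s) tmap (lact h1) (lact h2) t.

Let tr (t : V ⊗ W) (s : H ⊗ H) : V ⊗ W :=
  \tsum_(h1 ⊗ h2 <- s) tmap (ract^~ h2) (ract^~ h1) t.

Definition tens_lact (h : H) (t : V ⊗ W) : V ⊗ W :=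
  \tsum_(h1 ⊗ h2 <- Delta H h) tmap (lact h1) (lact h2) t.

(* The right action exchanges the two legs of [Delta h]. *)
Definition tens_ract (t : V ⊗ W) (h : H) : V ⊗ W :=
  \tsum_(h1 ⊗ h2 <- Delta H h) tmap (ract^~ h2) (ract^~ h1) t.

Let ll (X : bimodType H) (h : H) : linear (lact h : X -> X).
Proof. exact: lact_bilin.2. Qed.

Let rl (X : bimodType H) (h : H) : linear ((ract^~ h) : X -> X).
Proof. exact: ract_bilin.1. Qed.

Let tl_bilin t : bilin (fun h1 h2 : H => tmap (lact h1) (lact h2) t : V ⊗ W).
Proof.
split=> [h2|h1]; apply: tlift_param => u v a x y.
  by rewrite (lact_bilin.1 u) tensDl tensZl.
by rewrite (lact_bilin.1 v) tensDr tensZr.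
Qed.

Let tr_bilin t :
  bilin (fun h1 h2 : H => tmap (ract^~ h2) (ract^~ h1) t : V ⊗ W).
Proof.
split=> [h2|h1]; apply: tlift_param => u v a x y.
  by rewrite (ract_bilin.2 v) tensDr tensZr.
by rewrite (ract_bilin.2 u) tensDl tensZl.
Qed.

Let tl_lin1 t : linear (tl^~ t). Proof. exact: tlift_linear. Qed.
Let tr_lin1 t : linear (tr t). Proof. exact: tlift_linear. Qed.

Let tl_lin2 s : linear (tl s).
Proof. by apply: tlift_param => h1 h2; apply: tmap_linear; apply: ll. Qed.
Let tr_lin2 s : linear (tr^~ s).
Proof. by apply: tlift_param => h1 h2; apply: tmap_linear; apply: rl. Qed.

Let tlE h1 h2 v w : tl (h1 ⊗ h2) (v ⊗ w) = (h1 ⇀ v) ⊗ (h2 ⇀ w).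
Proof. by rewrite /tl tlift_tens // (tmap_tens (ll _) (ll _)). Qed.

Let trE h1 h2 v w : tr (v ⊗ w) (h1 ⊗ h2) = (v ↼ h2) ⊗ (w ↼ h1).
Proof. by rewrite /tr tlift_tens // (tmap_tens (rl _) (rl _)). Qed.

Fact tens_lact_bilin : bilin tens_lact.
Proof.
split=> [t|h]; last exact: (tl_lin2 (Delta H h)).
by move=> a x y; rewrite /tens_lact linearP; apply: tl_lin1.
Qed.

Fact tens_ract_bilin : bilin tens_ract.
Proof.
split=> [h|t]; first exact: (tr_lin2 (Delta H h)).
by move=> a x y; rewrite /tens_ract linearP; apply: tr_lin1.
Qed.

Fact tens_lact1 t : tens_lact 1 t = t.
Proof.
rewrite /tens_lact -/(tl _ t) rmorph1; move: t.
apply: tens_ext => [||v w]; [exact: tl_lin2 | by [] |].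
by rewrite tlE !lact1.
Qed.

Fact tens_ract1 t : tens_ract t 1 = t.
Proof.
rewrite /tens_ract -/(tr t _) rmorph1; move: t.
apply: tens_ext => [||v w]; [exact: tr_lin2 | by [] |].
by rewrite trE !ract1.
Qed.

Let tlM s s' t : tl (s * s') t = tl s (tl s' t).
Proof.
move: s; apply: tens_ext => [a x y|a x y|h1 h2].
- by rewrite mulrDl -scalerAl tl_lin1.
- by rewrite tl_lin1.
move: s'; apply: tens_ext => [a x y|a x y|h3 h4].
- by rewrite mulrDr -scalerAr tl_lin1.
- by rewrite tl_lin1 tl_lin2.
move: t; apply: tens_ext => [|a x y|v w]; first exact: tl_lin2.
  by rewrite tl_lin2 tl_lin2.
by rewrite tensM !tlE !lactM.
Qed.

Let trM s s' t : tr t (s * s') = tr (tr t s) s'.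
Proof.
move: s; apply: tens_ext => [a x y|a x y|h1 h2].
- by rewrite mulrDl -scalerAl tr_lin1.
- by rewrite tr_lin1 tr_lin2.
move: s'; apply: tens_ext => [a x y|a x y|h3 h4].
- by rewrite mulrDr -scalerAr tr_lin1.
- by rewrite tr_lin1.
move: t; apply: tens_ext => [|a x y|v w]; first exact: tr_lin2.
  by rewrite tr_lin2 tr_lin2.
by rewrite tensM !trE !ractM.
Qed.

Let tlr s s' t : tr (tl s t) s' = tl s (tr t s').
Proof.
move: s; apply: tens_ext => [a x y|a x y|h1 h2].
- by rewrite tl_lin1 tr_lin2.
- by rewrite tl_lin1.
move: s'; apply: tens_ext => [a x y|a x y|h3 h4].
- by rewrite tr_lin1.
- by rewrite tr_lin1 tl_lin2.
move: t; apply: tens_ext => [a x y|a x y|v w].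
- by rewrite tl_lin2 tr_lin2.
- by rewrite tr_lin2 tl_lin2.
by rewrite tlE !trE tlE !lract.
Qed.

Fact tens_lactM h h' t : tens_lact (h * h') t = tens_lact h (tens_lact h' t).
Proof. by rewrite /tens_lact rmorphM; apply: tlM. Qed.

Fact tens_ractM h h' t : tens_ract t (h * h') = tens_ract (tens_ract t h) h'.
Proof. by rewrite /tens_ract rmorphM; apply: trM. Qed.

Fact tens_lract h h' t :
  tens_ract (tens_lact h t) h' = tens_lact h (tens_ract t h').
Proof. exact: tlr. Qed.

HB.instance Definition _ := isBimodule.Build k H (V ⊗ W)%type
  tens_lact_bilin tens_ract_bilin tens_lact1 tens_ract1
  tens_lactM tens_ractM tens_lract.

End TensorBimodule.

Section UnitBimodule.
Variables (k : fieldType) (H : quasiBialgebra k).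

Definition unit_lact (h : H) (c : k^o) : k^o := counit H h * c.
Definition unit_ract (c : k^o) (h : H) : k^o := c * counit H h.

Fact unit_lact_bilin : bilin unit_lact.
Proof.
split=> [c|h] a x y; rewrite /unit_lact.
  by rewrite linearP mulrDl -mulrA.
by rewrite mulrDr; congr (_ + _); apply: mulrCA.
Qed.

Fact unit_ract_bilin : bilin unit_ract.
Proof.
split=> [h|c] a x y; rewrite /unit_ract.
  by rewrite mulrDl; congr (_ + _); apply: esym; apply: mulrA.
by rewrite linearP mulrDr; congr (_ + _); apply: mulrCA.
Qed.

Fact unit_lact1 c : unit_lact 1 c = c.
Proof. by rewrite /unit_lact rmorph1 mul1r. Qed.

Fact unit_ract1 c : unit_ract c 1 = c.
Proof. by rewrite /unit_ract rmorph1 mulr1. Qed.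

Fact unit_lactM h h' c : unit_lact (h * h') c = unit_lact h (unit_lact h' c).
Proof. by rewrite /unit_lact rmorphM mulrA. Qed.

Fact unit_ractM h h' c : unit_ract c (h * h') = unit_ract (unit_ract c h) h'.
Proof. by rewrite /unit_ract rmorphM mulrA. Qed.

Fact unit_lract h h' c :
  unit_ract (unit_lact h c) h' = unit_lact h (unit_ract c h').
Proof. by rewrite /unit_ract /unit_lact mulrA. Qed.

HB.instance Definition _ := isBimodule.Build k H k^o
  unit_lact_bilin unit_ract_bilin unit_lact1 unit_ract1
  unit_lactM unit_ractM unit_lract.

End UnitBimodule.

Section Hlr.
Variables (k : fieldType) (H : quasiBialgebra k).
Implicit Types (U V W B : bimodType H).

Definition Hlr_morphism V W (f : V -> W) : Prop :=
  linear f /\ forall (h : H) v (h' : H), f (h ⇀ v ↼ h') = h ⇀ f v ↼ h'.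

Definition Hlr_assoc U V W (t : (U ⊗ V) ⊗ W) : U ⊗ V ⊗ W :=
  \tsum_(x1 ⊗ x2 ⊗ x3 <- Phi H) \tsum_(y1 ⊗ y2 ⊗ y3 <- Phi H)
    tmap (fun u => x1 ⇀ u ↼ y3)
      (tmap (fun v => x2 ⇀ v ↼ y2) (fun w => x3 ⇀ w ↼ y1)) (tassoc t).

Definition Hlr_lunit V (t : k^o ⊗ V) :  V :=
  tlift (fun (c : k^o) (v : V) => (c : k) *: v) t.
Definition Hlr_runit V (t : V ⊗ k^o) :  V :=
  tlift (fun (v : V) (c : k^o) => (c : k) *: v) t.

(* [eta c] is [c] times the unit element of [B]; [m] and [eta] are required   *)
(* to be morphisms of bimodules.                                              *)
Record Hlr_algebra B (m : B ⊗ B -> B) (eta : k^o -> B) : Prop := HlrAlgebra {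
  Hlr_mul_morphism : Hlr_morphism m;
  Hlr_unit_morphism : Hlr_morphism eta;
  Hlr_mulA : forall t : (B ⊗ B) ⊗ B, m (tmap m id t) = m (tmap id m (Hlr_assoc t));
  Hlr_mul1l : forall t : k^o ⊗ B, m (tmap eta id t) = Hlr_lunit t;
  Hlr_mul1r : forall t : B ⊗ k^o, m (tmap id eta t) = Hlr_runit t
}.

End Hlr.

Section Braiding.
Variables (k : fieldType) (H : quasitriangular k).

Definition Hlr_braiding (V W : bimodType H) (t : V ⊗ W) : W ⊗ V :=
  \tsum_(v ⊗ w <- t) \tsum_(r1 ⊗ r2 <- Rmx H) \tsum_(u1 ⊗ u2 <- RmxV H)
    (r2 ⇀ w ↼ u1) ⊗ (r1 ⇀ v ↼ u2).

Definition quantum_commutative (B : bimodType H) (m : B ⊗ B -> B) : Prop :=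
  forall t, m (Hlr_braiding t) = m t.

End Braiding.

Section Convolution.
Variables (k : fieldType) (H : quasiBialgebra k).

Let conv_in_bilin (f g : dual H) : bilin (fun h1 h2 : H => f h1 * g h2 : k^o).
Proof.
split=> [y|x] a u v; first by rewrite linearP mulrDl -mulrA.
by rewrite linearP mulrDr; congr (_ + _); apply: mulrCA.
Qed.

Fact conv_scalar (f g : dual H) :
  scalar (fun h => \tsum_(h1 ⊗ h2 <- Delta H h) (f h1 * g h2 : k^o) : k).
Proof. by move=> a x y; rewrite linearP; apply: (tlift_linear (conv_in_bilin f g)). Qed.

Definition conv (f g : dual H) : dual H := mkdual (conv_scalar f g).

Lemma conv_bilin : bilin conv.
Proof.
split=> [g|f] a x y; apply: dual_ext => h.
  apply: (tlift_param (F := fun (x : dual H) h1 h2 => x h1 * g h2 : k^o)).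
  by move=> u v b {}x {}y; rewrite /= mulrDl -mulrA.
apply: (tlift_param (F := fun (x : dual H) h1 h2 => f h1 * x h2 : k^o)).
by move=> u v b {}x {}y; rewrite /= mulrDr mulrCA.
Qed.

Definition dual_counit : dual H := counit H.

End Convolution.

Section HstarR.
Variables (k : fieldType) (H : quasitriangular k).
Implicit Types f g : dual H.

Definition mulR f g : dual H :=
  \tsum_(r1 ⊗ r2 <- Rmx H) conv (r2 ⇀ g) (r1 ⇀ f).

Lemma mulRE f g h : mulR f g h =
  \tsum_(h1 ⊗ h2 <- Delta H h) \tsum_(r1 ⊗ r2 <- Rmx H)
    (g (h1 * r2) * f (h2 * r1) : k^o).
Proof. by rewrite /mulR /tlift dual_sumE exchange_big. Qed.

Lemma mulR_bilin : bilin mulR.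
Proof.
split=> [g|f]; apply: tlift_param => r1 r2 a x y.
  by rewrite (lact_bilin.2 r1) (@conv_bilin _ H).2.
by rewrite (lact_bilin.2 r2) (@conv_bilin _ H).1.
Qed.

Definition mulR_map : dual H ⊗ dual H -> dual H := tlift mulR.
Definition unitR_map (c : k^o) : dual H := (c : k) *: dual_counit H.

End HstarR.

Notation "f · g" := (mulR f g) : ring_scope.

(* Main.v *)
Require Import Defs.
From mathcomp Require Import all_boot all_order all_algebra.

Import GRing.Theory.
Local Open Scope ring_scope.

Set Implicit Arguments.
Unset Strict Implicit.
Unset Printing Implicit Defensive.

(** The product of [H*_R] is the transpose of a linear map [T : H -> H ⊗ H].
Write [<f ⊗ g, a ⊗ b> = f a * g b], and take [T x = R Δ(x)]. As [Δ] and
[Δ^cop] are conjugate under [R], also [T x = Δ^cop(x) R], and the definition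
of the product reads [(f · g)(x) = <f ⊗ g, T x>] (lemma [mulR_dual_tens]).
Since [<h ⇀ f ↼ h', a> = f (h' a h)], every claim about products becomes an
identity between elements of [H ⊗ H] or [H ⊗ H ⊗ H].

- The product is a bimodule map because
  [T (h' x h) = Δ^cop(h') T(x) Δ(h)]; the flip in [Δ^cop(h')] is the exchange
  of legs in the right action on a tensor product ([mulR_bimodule]).
- Quantum commutativity is [T x = flip (R^-1 T x) R]
  ([mulR_quantum_commutative]).
- Associativity up to the constraint: the left side pairs [f ⊗ g ⊗ l] with
  [R_12 (Δ ⊗ I)(R) (Δ ⊗ I)(Δ x)], the right side with
  [Φ_321 R_23 (I ⊗ Δ)(R) (I ⊗ Δ)(Δ x) Φ]. Quasi-coassociativity moves [Φ] past
  the iterated comultiplication, so it remains that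
  [R_12 (Δ ⊗ I)(R) = Φ_321 R_23 (I ⊗ Δ)(R) Φ]. This is the quasi-Yang-Baxter
  equation [quasi_Yang_Baxter]: moving [R_12] across [Δ ⊗ I] turns the left
  side into the first hexagon with legs 1 and 2 exchanged, times [R_12], and
  that is the second hexagon with [Φ_321 R_23] in front and [Φ] behind.
- [ε] is a unit because [(ε ⊗ I)(R) = 1 = (I ⊗ ε)(R)]. These follow from the
  hexagons once [ε] applied to an outer leg of [Φ] is known to give [1]. Only
  the middle leg is covered by the axioms; for the outer ones, two counits
  applied to the pentagon show that the element in question is an invertible
  idempotent ([first_counit_Phi], [last_counit_Phi]).

The statements about maps on tensor products reduce to these identities on
pure tensors, both sides being linear. *)

(** * Linear maps on tensor products *)

Section Linear.
Variables (k : fieldType).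

Lemma tens_sum (U V : lmodType k) (t : U ⊗ V) : t = \tsum_(u ⊗ v <- t) u ⊗ v.
Proof.
apply/esym; move: t.
apply: tens_ext => [||u v]; [exact/tlift_linear/bilin_tens | by [] |].
exact/tlift_tens/bilin_tens.
Qed.

Lemma linear_tlift (U V W X : lmodType k) (G : W -> X) (F : U -> V -> W) t :
  linear G -> G (tlift F t) = \tsum_(u ⊗ v <- t) G (F u v).
Proof. by move=> Gl; apply: big_morph; [exact: linD | exact: lin0]. Qed.

(** Bilinearity of [F] need not be proved separately: it is inherited from
linearity of [G]. This is how the iterated sums of Sweedler notation are
folded into products in a tensor power of the algebra. *)
Lemma tlift_eq (U V W : lmodType k) (F : U -> V -> W) (G : U ⊗ V -> W) t :
  linear G -> (forall u v, F u v = G (u ⊗ v)) -> tlift F t = G t.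
Proof.
by move=> Gl FG; rewrite [in RHS](tens_sum t) linear_tlift //; apply: eq_tlift.
Qed.

Lemma tlift3_eq (U V W X : lmodType k) (F : U -> V -> W -> X)
    (G : U ⊗ V ⊗ W -> X) t :
  linear G -> (forall u v w, F u v w = G (u ⊗ v ⊗ w)) ->
  \tsum_(u ⊗ v ⊗ w <- t) F u v w = G t.
Proof.
move=> Gl FG.
have := @tlift_eq _ _ _ (fun u => tlift (F u)) G t Gl; apply=> u s.
apply: (tlift_eq (G := fun r => G (u ⊗ r))) => // a x y.
by rewrite tensDr tensZr Gl.
Qed.

Lemma tens3_ext (U V W X : lmodType k) (g h : U ⊗ V ⊗ W -> X) :
  linear g -> linear h ->
  (forall u v w, g (u ⊗ v ⊗ w) = h (u ⊗ v ⊗ w)) -> g =1 h.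
Proof.
move=> gl hl gh t.
rewrite -(tlift3_eq (F := fun u v w => g (u ⊗ v ⊗ w)) _ gl) //.
exact: tlift3_eq.
Qed.

Lemma id_linear (U : lmodType k) : linear (fun x : U => x).
Proof. by []. Qed.

Lemma comp_linear (U V W : lmodType k) (g : V -> W) (f : U -> V) :
  linear g -> linear f -> linear (fun x => g (f x)).
Proof. by move=> gl fl a x y; rewrite fl gl. Qed.

Lemma tensl_linear (U V : lmodType k) (u : U) : linear (fun v : V => u ⊗ v).
Proof. exact: (bilin_tens _ _).2. Qed.

Lemma tensr_linear (U V : lmodType k) (v : V) : linear (fun u : U => u ⊗ v).
Proof. exact: (bilin_tens _ _).1. Qed.

Lemma mulll_linear (A : algType k) (a : A) : linear (fun x : A => a * x).
Proof. by move=> c x y; rewrite mulrDr -scalerAr. Qed.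

Lemma mulrr_linear (A : algType k) (a : A) : linear (fun x : A => x * a).
Proof. by move=> c x y; rewrite mulrDl -scalerAl. Qed.

Lemma scale_linear (U : lmodType k) (a : k) : linear (fun x : U => a *: x).
Proof. by move=> b x y; rewrite scalerDr !scalerA mulrC. Qed.

Lemma scale_bilin (U : lmodType k) :
  bilin (fun (a : k^o) (x : U) => (a : k) *: x).
Proof.
by split=> [x|a] b y z; [rewrite scalerDl scalerA | exact: scale_linear].
Qed.

Lemma scaler_bilin (U : lmodType k) :
  bilin (fun (x : U) (a : k^o) => (a : k) *: x).
Proof. by have [l r] := scale_bilin U; split. Qed.

Lemma lrmorphism_linear (A B : algType k) (f : {lrmorphism A -> B}) : linear f.
Proof. exact: linearP. Qed.

Lemma dual_linear (V : lmodType k) (f : dual V) : linear (f : V -> k^o).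
Proof. exact: linearP. Qed.

Lemma dual_comp_linear (U V : lmodType k) (d : dual V) (f : U -> V) :
  linear f -> linear (fun x => d (f x) : k^o).
Proof. by move=> fl a x y; rewrite fl linearP. Qed.

Lemma tassoc_inner_bilin (U V W : lmodType k) :
  bilin (fun (s : U ⊗ V) (w : W) => \tsum_(u ⊗ v <- s) u ⊗ v ⊗ w).
Proof.
split=> [w|s].
  apply: tlift_linear; split=> [v|u] a x y; first by rewrite tensDl tensZl.
  by rewrite tensDl tensZl tensDr tensZr.
by apply: tlift_param => u v a x y; rewrite !tensDr !tensZr.
Qed.

Lemma tassoc_linear (U V W : lmodType k) : linear (@tassoc k U V W).
Proof. exact/tlift_linear/tassoc_inner_bilin. Qed.

Lemma tassoc_tens (U V W : lmodType k) (u : U) (v : V) (w : W) :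
  tassoc ((u ⊗ v) ⊗ w) = u ⊗ v ⊗ w.
Proof.
rewrite /tassoc tlift_tens; last exact: tassoc_inner_bilin.
apply: tlift_tens; split=> [b|b] a x y; first by rewrite tensDl tensZl.
by rewrite tensDl tensZl tensDr tensZr.
Qed.

End Linear.

Section TripleLift.
Variables (k : fieldType) (U V W X : lmodType k) (F : U -> V -> W -> X).
Hypotheses (F1 : forall v w, linear (fun u => F u v w))
  (F2 : forall u w, linear (fun v => F u v w)) (F3 : forall u v, linear (F u v)).

Lemma tlift3_bilin : bilin (fun u => tlift (F u)).
Proof.
split=> [t|u]; last exact: tlift_linear.
by apply: tlift_param => v w; apply: F1.
Qed.

Lemma tlift3_linear : linear (fun t => \tsum_(u ⊗ v ⊗ w <- t) F u v w).
Proof. exact: tlift_linear tlift3_bilin. Qed.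

Lemma tlift3_tens a b c : \tsum_(u ⊗ v ⊗ w <- a ⊗ b ⊗ c) F u v w = F a b c.
Proof.
rewrite tlift_tens; last exact: tlift3_bilin.
by rewrite tlift_tens.
Qed.

End TripleLift.

(** Splits a function given by a lambda term into linear functions of one
argument, down to the tensor operations, hypotheses of the context, and the
hints in the database [lin]. The functionals are a case of their own because
their values must be read in the module [k^o] rather than in [k]. *)
Ltac lin :=
  match goal with
  | |- GRing.linear_for _ (fun x => x) => exact: id_linear
  | |- GRing.linear_for _ (fun x => ?g x) => change (linear g); lin
  | |- GRing.linear_for _ (fun x => GRing.Linear.sort ?d (@?f x)) =>
      refine (@dual_comp_linear _ _ _ d f _); lin
  | |- GRing.linear_for _ (fun x => GRing.mul (@?f x) ?a) =>
      refine (@comp_linear _ _ _ _ (fun y => y * a) f (mulrr_linear a) _); lin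
  | |- GRing.linear_for _ (fun x => tens (@?f x) ?a) =>
      refine (@comp_linear _ _ _ _ (fun y => y ⊗ a) f (tensr_linear a) _); lin
  | |- GRing.linear_for _ (fun x => ?g (@?f x)) =>
      refine (@comp_linear _ _ _ _ g f _ _); lin
  | |- GRing.linear_for _ (GRing.mul _) => exact: mulll_linear
  | |- GRing.linear_for _ (GRing.scale _) => exact: scale_linear
  | |- GRing.linear_for _ (tens _) => exact: tensl_linear
  | |- GRing.linear_for _ (@tassoc _ _ _ _) => exact: tassoc_linear
  | |- GRing.linear_for _ (tmap _ _) => apply: tmap_linear; lin
  | |- _ => first [assumption
                  | match goal with
                    | h : forall _, GRing.linear_for _ _ |- _ => exact: h
                    end
                  | solve [auto with lin]
                  | exact: lrmorphism_linear | exact: dual_linear]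
  end.

(** * Algebra morphisms between tensor powers *)

Section AlgMorphism.
Variable k : fieldType.
Implicit Types A B C D : algType k.

(** A predicate rather than a bundled structure, so that it applies directly to
the lambda terms and to [id] in the axioms of a quasi-bialgebra. *)
Definition alg_morphism A B (f : A -> B) : Prop :=
  [/\ linear f, f 1 = 1 & {morph f : x y / x * y}].

Lemma alg_morphism_tens A B C (f : A ⊗ B -> C) :
  linear f -> f 1 = 1 ->
  (forall a b c d, f ((a * c) ⊗ (b * d)) = f (a ⊗ b) * f (c ⊗ d)) ->
  alg_morphism f.
Proof.
move=> fl f1 fM; split=> // x y; move: x.
apply: tens_ext => [||a b]; [by lin | by lin |].
by move: y; apply: tens_ext => [||c d]; [lin | lin | rewrite tensM fM].
Qed.

Lemma alg_morphism_tens3 A B C D (f : A ⊗ B ⊗ C -> D) :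
  linear f -> f 1 = 1 ->
  (forall a b c a' b' c',
    f ((a * a') ⊗ (b * b') ⊗ (c * c')) = f (a ⊗ b ⊗ c) * f (a' ⊗ b' ⊗ c')) ->
  alg_morphism f.
Proof.
move=> fl f1 fM; split=> // x y; move: x.
apply: tens3_ext => [||a b c]; [by lin | by lin |].
move: y; apply: tens3_ext => [||a' b' c']; [by lin | by lin |].
by rewrite !tensM fM.
Qed.

Lemma alg_morphism_id A : alg_morphism (fun x : A => x).
Proof. by []. Qed.

Lemma alg_morphism_comp A B C (g : B -> C) (f : A -> B) :
  alg_morphism g -> alg_morphism f -> alg_morphism (fun x => g (f x)).
Proof.
case=> gl g1 gM [fl f1 fM]; split; first exact: comp_linear gl fl.
  by rewrite f1.
by move=> x y; rewrite fM gM.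
Qed.

Lemma alg_morphism_inv A B (f : A -> B) x y :
  alg_morphism f -> x * y = 1 -> f x = 1 -> f y = 1.
Proof. by case=> _ f1 fM xy fx; rewrite -[f y]mul1r -{1}fx -fM xy. Qed.

Lemma alg_morphism_tmap A B C D (f : A -> C) (g : B -> D) :
  alg_morphism f -> alg_morphism g -> alg_morphism (tmap f g).
Proof.
case=> fl f1 fM [gl g1 gM]; apply: alg_morphism_tens => [||a b c d].
- exact: tmap_linear.
- by rewrite tmap_tens // f1 g1.
- by rewrite !tmap_tens // tensM fM gM.
Qed.

Lemma alg_morphism_tassoc A B C : alg_morphism (@tassoc k A B C).
Proof.
apply: alg_morphism_tens => [||s c t d].
- exact: tassoc_linear.
- exact: tassoc_tens.
move: s; apply: tens_ext => [||a b]; [by lin | by lin |].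
move: t; apply: tens_ext => [||a' b']; [by lin | by lin |].
by rewrite tensM !tassoc_tens !tensM.
Qed.

End AlgMorphism.

(** * Permutations of the legs *)

Section Legs.
Variables (k : fieldType) (A : algType k).
Implicit Types (a b c : A) (r : A ⊗ A) (t : A ⊗ A ⊗ A).

Definition leg_321 t : A ⊗ A ⊗ A := \tsum_(x1 ⊗ x2 ⊗ x3 <- t) x3 ⊗ x2 ⊗ x1.

Lemma leg_132_linear : linear (@leg_132 k A).
Proof. by apply: tlift3_linear => ? ?; lin. Qed.

Lemma leg_132_tens a b c : leg_132 (a ⊗ b ⊗ c) = a ⊗ c ⊗ b.
Proof. by apply: tlift3_tens => ? ?; lin. Qed.

Lemma leg_213_linear : linear (@leg_213 k A).
Proof. by apply: tlift3_linear => ? ?; lin. Qed.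

Lemma leg_213_tens a b c : leg_213 (a ⊗ b ⊗ c) = b ⊗ a ⊗ c.
Proof. by apply: tlift3_tens => ? ?; lin. Qed.

Lemma leg_231_linear : linear (@leg_231 k A).
Proof. by apply: tlift3_linear => ? ?; lin. Qed.

Lemma leg_231_tens a b c : leg_231 (a ⊗ b ⊗ c) = c ⊗ a ⊗ b.
Proof. by apply: tlift3_tens => ? ?; lin. Qed.

Lemma leg_312_linear : linear (@leg_312 k A).
Proof. by apply: tlift3_linear => ? ?; lin. Qed.

Lemma leg_312_tens a b c : leg_312 (a ⊗ b ⊗ c) = b ⊗ c ⊗ a.
Proof. by apply: tlift3_tens => ? ?; lin. Qed.

Lemma leg_321_linear : linear leg_321.
Proof. by apply: tlift3_linear => ? ?; lin. Qed.

Lemma leg_321_tens a b c : leg_321 (a ⊗ b ⊗ c) = c ⊗ b ⊗ a.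
Proof. by apply: tlift3_tens => ? ?; lin. Qed.

Lemma tflip_bilin : bilin (fun a b : A => b ⊗ a).
Proof. by split=> ?; lin. Qed.

Lemma tflip_linear : linear (@tflip k A).
Proof. exact: tlift_linear tflip_bilin. Qed.

Lemma tflip_tens a b : tflip (a ⊗ b) = b ⊗ a.
Proof. exact: tlift_tens tflip_bilin. Qed.

Lemma leg_13E r : leg_13 r = tmap id (tens 1) r.
Proof.
apply: (tlift_eq (G := tmap id (tens 1))) => [|a b]; first by lin.
by rewrite tmap_tens //; lin.
Qed.

Lemma leg_13_linear : linear (@leg_13 k A).
Proof.
move=> a x y; rewrite !leg_13E; move: a x y.
by apply: tmap_linear; [exact: id_linear | exact: tensl_linear].
Qed.

End Legs.

#[export] Hint Extern 0 (GRing.linear_for _ _) =>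
  first [exact: leg_132_linear | exact: leg_213_linear | exact: leg_231_linear
        | exact: leg_312_linear | exact: leg_321_linear | exact: tflip_linear | exact: leg_13_linear]
  : lin.

Section LegIdentities.
Variables (k : fieldType) (A : algType k).
Implicit Types (a b c : A) (r : A ⊗ A) (t : A ⊗ A ⊗ A).

Lemma alg_morphism_tflip : alg_morphism (@tflip k A).
Proof.
apply: alg_morphism_tens => [||a b c d]; first exact: tflip_linear.
  exact: tflip_tens.
by rewrite !tflip_tens tensM.
Qed.

Lemma alg_morphism_leg_213 : alg_morphism (@leg_213 k A).
Proof.
apply: alg_morphism_tens3 => [||a b c a' b' c']; first exact: leg_213_linear.
  exact: leg_213_tens.
by rewrite !leg_213_tens !tensM.
Qed.

Lemma leg_12E r : leg_12 r = tassoc (r ⊗ 1).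
Proof.
by apply: (tlift_eq (G := fun r => tassoc (r ⊗ 1))) => [|a b];
  [lin | rewrite tassoc_tens].
Qed.

Lemma leg_23E r : leg_23 r = 1 ⊗ r.
Proof. by apply: (tlift_eq (G := tens 1)) => //; lin. Qed.

(** [leg_213] exchanges the legs of [Δ a] in [(Δ ⊗ I)(a ⊗ b)]; this is where
conjugation by [R_12] enters the quasi-Yang-Baxter equation. *)
Lemma leg_213_tassoc r a : leg_213 (tassoc (r ⊗ a)) = tassoc (tflip r ⊗ a).
Proof.
move: r; apply: tens_ext => [||b c]; [by lin | by lin |].
by rewrite tflip_tens !tassoc_tens leg_213_tens.
Qed.

Lemma leg_213_312 t : leg_213 (leg_312 t) = leg_321 t.
Proof.
move: t; apply: tens3_ext => [||a b c]; [by lin | by lin |].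
by rewrite leg_312_tens leg_213_tens leg_321_tens.
Qed.

Lemma leg_213_132 t : leg_213 (leg_132 t) = leg_231 t.
Proof.
move: t; apply: tens3_ext => [||a b c]; [by lin | by lin |].
by rewrite leg_132_tens leg_213_tens leg_231_tens.
Qed.

Lemma leg_213_13 r : leg_213 (leg_13 r) = leg_23 r.
Proof.
rewrite leg_13E leg_23E; move: r.
apply: tens_ext => [||b c]; [by lin | by lin |].
by rewrite tmap_tens ?leg_213_tens //; lin.
Qed.

Lemma leg_213_23 r : leg_213 (leg_23 r) = leg_13 r.
Proof.
rewrite leg_13E leg_23E; move: r.
apply: tens_ext => [||b c]; [by lin | by lin |].
by rewrite tmap_tens ?leg_213_tens //; lin.
Qed.

End LegIdentities.

(** * Counits of the associator *)

Section Counit.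
Variables (k : fieldType) (H : quasiBialgebra k).
Implicit Types (V W : lmodType k) (B : algType k).

Definition counitL V (t : H ⊗ V) : V := \tsum_(h ⊗ v <- t) counit H h *: v.
Definition counitR V (t : V ⊗ H) : V := \tsum_(v ⊗ h <- t) counit H h *: v.

Lemma counitL_bilin V : bilin (fun (h : H) (v : V) => counit H h *: v).
Proof.
split=> [v|h] a x y; first by rewrite linearP scalerDl scalerA.
by rewrite linearP.
Qed.

Lemma counitR_bilin V : bilin (fun (v : V) (h : H) => counit H h *: v).
Proof. by have [l r] := counitL_bilin V; split. Qed.

Lemma counitL_linear V : linear (@counitL V).
Proof. exact: tlift_linear (counitL_bilin V). Qed.

Lemma counitR_linear V : linear (@counitR V).
Proof. exact: tlift_linear (counitR_bilin V). Qed.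

Lemma counitL_tens V h (v : V) : counitL (h ⊗ v) = counit H h *: v.
Proof. exact: tlift_tens (counitL_bilin V). Qed.

Lemma counitR_tens V (v : V) h : counitR (v ⊗ h) = counit H h *: v.
Proof. exact: tlift_tens (counitR_bilin V). Qed.

Hint Extern 0 (GRing.linear_for _ (@counitL _)) => exact: counitL_linear : lin.
Hint Extern 0 (GRing.linear_for _ (@counitR _)) => exact: counitR_linear : lin.

Lemma alg_morphism_counitL B : alg_morphism (@counitL B).
Proof.
apply: alg_morphism_tens => [||a b c d]; first exact: counitL_linear.
  by rewrite counitL_tens rmorph1 scale1r.
by rewrite !counitL_tens rmorphM -scalerAl -scalerAr scalerA.
Qed.

Lemma alg_morphism_counitR B : alg_morphism (@counitR B).
Proof.
apply: alg_morphism_tens => [||a b c d]; first exact: counitR_linear.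
  by rewrite counitR_tens rmorph1 scale1r.
by rewrite !counitR_tens rmorphM -scalerAl -scalerAr scalerA.
Qed.

Lemma counitL_Delta h : counitL (Delta H h) = h.
Proof. exact: counit_l. Qed.

Lemma counitR_Delta h : counitR (Delta H h) = h.
Proof. exact: counit_r. Qed.

Lemma counitL_tassoc V W (s : H ⊗ V) (w : W) :
  counitL (tassoc (s ⊗ w)) = counitL s ⊗ w.
Proof.
move: s; apply: tens_ext => [||a b]; [by lin | by lin |].
by rewrite tassoc_tens !counitL_tens tensZl.
Qed.

Lemma mid_counit_Phi : tmap id (@counitL H) (Phi H) = 1.
Proof.
rewrite -(Phi_counit H); apply/esym; apply: tlift3_eq => [|a b c]; first by lin.
by rewrite tmap_tens ?counitL_tens ?tensZr //; lin.
Qed.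

Lemma Delta_linear : linear (Delta H).
Proof. exact: lrmorphism_linear. Qed.

Lemma alg_morphism_Delta : alg_morphism (Delta H).
Proof.
by split; [exact: lrmorphism_linear | exact: rmorph1 | exact: rmorphM].
Qed.

Lemma idempotent_unit (B : algType k) (x y : B) : x * y = 1 -> x * x = x -> x = 1.
Proof. by move=> xy xx; rewrite -[RHS]xy -[in RHS]xx -mulrA xy mulr1. Qed.

Lemma alg_morphism_mid_counit :
  alg_morphism (tmap id (@counitL H) : H ⊗ H ⊗ H -> H ⊗ H).
Proof.
by apply: alg_morphism_tmap; [exact: alg_morphism_id | exact: alg_morphism_counitL].
Qed.

(** With [φ] for the left side, applying [ε] to legs 1 and 2 of the pentagon
gives [φ = φ * φ]: the factors where [ε] hits the middle leg of [Φ] become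
[1], and [ε] cancels the [Δ] next to it. An invertible idempotent is [1]. *)
Lemma first_counit_Phi : counitL (Phi H) = 1.
Proof.
have Dl := Delta_linear.
have e1a B : alg_morphism (@counitL B) by exact: alg_morphism_counitL.
(* [B] stays arbitrary: [F] is applied to [Φ] and to elements of [H ⊗ H ⊗ H ⊗ H]. *)
pose F (B : algType k) (t : H ⊗ H ⊗ B) := counitL (counitL t).
have FA B : alg_morphism (F B) by apply: alg_morphism_comp.
have Fl (B : algType k) : linear (F B) by have [] := FA B.
have Ft (B : algType k) a b (c : B) :
    F B (a ⊗ b ⊗ c) = (counit H a * counit H b) *: c.
  by rewrite /F counitL_tens (linZ (@counitL_linear _)) counitL_tens scalerA.
have FPhi : F _ (Phi H) = 1.
  have -> : F _ (Phi H) = counitL (tmap id (@counitL H) (Phi H)).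
    move: (Phi H); apply: tens_ext => [||a t]; [by lin | by lin |].
    rewrite tmap_tens //; last by lin.
    by rewrite /F !counitL_tens (linZ (@counitL_linear _)).
  by rewrite mid_counit_Phi; case: (e1a H).
(* The values of [F] on the factors of the pentagon, from left to right. *)
have F1 : F _ (tmap id (tmap id (Delta H)) (Phi H)) = Delta H (F _ (Phi H)).
  move: (Phi H); apply: tens3_ext => [||a b c]; [by lin | by lin |].
  rewrite !tmap_tens //; [| by lin ..].
  by rewrite !Ft (linZ Dl).
have F2 : F _ (tassoc (tmap (Delta H) id (Phi H))) = counitL (Phi H).
  move: (Phi H); apply: tens_ext => [||a t]; [by lin | by lin |].
  by rewrite tmap_tens // /F counitL_tassoc counitL_tens counitL_Delta counitL_tens.
have F3 : F _ (1 ⊗ Phi H) = counitL (Phi H).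
  by rewrite /F counitL_tens rmorph1 scale1r.
have F4 : F _ (tmap id (fun t => tassoc (tmap (Delta H) id t)) (Phi H))
    = counitL (Phi H).
  move: (Phi H); apply: tens3_ext => [||a b c]; [by lin | by lin |].
  rewrite !tmap_tens //; [| by lin ..].
  rewrite /F !counitL_tens (linZ (@counitL_linear _)) counitL_tassoc.
  by rewrite counitL_Delta.
have F5 : F _ (tmap id (@tassoc _ _ _ _) (tassoc (Phi H ⊗ 1)))
    = F _ (Phi H) ⊗ (1 : H).
  move: (Phi H); apply: tens3_ext => [||a b c]; [by lin | by lin |].
  rewrite tassoc_tens !tmap_tens //; last by lin.
  by rewrite tassoc_tens !Ft tensZl.
apply: (@idempotent_unit _ _ (counitL (PhiV H))).
  by case: (e1a (H ⊗ H)%type) => _ <- <-; rewrite mulPhiV.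
have [_ _ FM] := FA (H ⊗ H)%type.
have := congr1 (F _) (pentagon H).
by rewrite !FM F1 F2 F3 F4 F5 FPhi rmorph1 mul1r mulr1.
Qed.

Lemma alg_morphism_last_counit :
  alg_morphism (tmap id (@counitR H) : H ⊗ H ⊗ H -> H ⊗ H).
Proof.
by apply: alg_morphism_tmap; [exact: alg_morphism_id | exact: alg_morphism_counitR].
Qed.

(** The mirror image of [first_counit_Phi], with [ε] on legs 3 and 4 of the
pentagon. *)
Lemma last_counit_Phi : tmap id (@counitR H) (Phi H) = 1.
Proof.
have Dl := Delta_linear.
pose L (t : H ⊗ H ⊗ H) : H ⊗ H := tmap id (@counitR H) t.
have LA : alg_morphism L by exact: alg_morphism_last_counit.
pose E (t : H ⊗ H ⊗ H) : H := counitR (tmap id (@counitL H) t).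
have EPhi : E (Phi H) = 1.
  by rewrite /E mid_counit_Phi; case: (alg_morphism_counitR H).
pose G (t : H ⊗ H ⊗ H ⊗ H) : H ⊗ H :=
  L (tmap id (tmap id (@counitR H)) t).
have GA : alg_morphism G.
  apply: alg_morphism_comp => //.
  by apply: alg_morphism_tmap; [exact: alg_morphism_id | exact: LA].
have Ll : linear L by case: LA.
have Gl : linear G by case: GA.
have El : linear E by rewrite /E; lin.
have Lt a b c : L (a ⊗ b ⊗ c) = counit H c *: (a ⊗ b).
  by rewrite /L tmap_tens ?counitR_tens ?tensZr //; lin.
have Et a b c : E (a ⊗ b ⊗ c) = (counit H b * counit H c) *: a.
  rewrite /E tmap_tens ?counitL_tens ?tensZr //; last by lin.
  by rewrite (linZ (@counitR_linear _)) counitR_tens scalerA.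
have Gt a b c d : G (a ⊗ b ⊗ c ⊗ d) = (counit H c * counit H d) *: (a ⊗ b).
  rewrite /G tmap_tens // tmap_tens //; last by lin.
  by rewrite counitR_tens !tensZr (linZ Ll) Lt scalerA mulrC.
(* The values of [G] on the factors of the pentagon, from left to right. *)
have G1 : G (tmap id (tmap id (Delta H)) (Phi H)) = L (Phi H).
  move: (Phi H); apply: tens3_ext => [||a b c]; [by lin | by lin |].
  rewrite !tmap_tens //; [| by lin ..].
  rewrite /G tmap_tens // tmap_tens //; last by lin.
  by rewrite counitR_Delta.
have G2 : G (tassoc (tmap (Delta H) id (Phi H))) = Delta H (E (Phi H)).
  move: (Phi H); apply: tens3_ext => [||a b c]; [by lin | by lin |].
  rewrite tmap_tens // Et (linZ Dl).
  move: (Delta H a); apply: tens_ext => [||a1 a2]; [by lin | by lin |].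
  by rewrite tassoc_tens Gt.
have G3 : G (1 ⊗ Phi H) = 1 ⊗ E (Phi H).
  move: (Phi H); apply: tens3_ext => [||a b c]; [by lin | by lin |].
  by rewrite Gt Et tensZr.
have G4 : G (tmap id (fun t => tassoc (tmap (Delta H) id t)) (Phi H))
    = L (Phi H).
  move: (Phi H); apply: tens3_ext => [||a b c]; [by lin | by lin |].
  rewrite !tmap_tens //; [| by lin ..].
  rewrite Lt -{2}[b]counitR_Delta.
  move: (Delta H b); apply: tens_ext => [||b1 b2]; [by lin | by lin |].
  by rewrite tassoc_tens Gt counitR_tens tensZr scalerA mulrC.
have G5 : G (tmap id (@tassoc _ _ _ _) (tassoc (Phi H ⊗ 1))) = L (Phi H).
  move: (Phi H); apply: tens3_ext => [||a b c]; [by lin | by lin |].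
  rewrite tassoc_tens !tmap_tens //; last by lin.
  by rewrite tassoc_tens Gt Lt rmorph1 mulr1.
have [_ L1 LM] := LA; have [_ _ GM] := GA.
apply: (@idempotent_unit _ _ (L (PhiV H))).
  by rewrite -LM mulPhiV L1.
have := congr1 G (pentagon H).
by rewrite !GM G1 G2 G3 G4 G5 EPhi rmorph1 -tens1E mul1r mulr1.
Qed.

End Counit.

#[export] Hint Extern 0 (GRing.linear_for _ (@counitL _ _ _)) =>
  exact: counitL_linear : lin.
#[export] Hint Extern 0 (GRing.linear_for _ (@counitR _ _ _)) =>
  exact: counitR_linear : lin.

(** * Consequences of the hexagons *)

Section RMatrix.
Variables (k : fieldType) (H : quasitriangular k).

(** Applying [ε] to leg 1 of the first hexagon, where all the associators become
[1], leaves [R = (1 ⊗ r) * R] with [r = (ε ⊗ I)(R)], and [R] is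
invertible. *)
Lemma counitL_R : counitL (Rmx H) = 1.
Proof.
have [_ _ cM] := alg_morphism_counitL H (H ⊗ H)%type.
have Dl := @Delta_linear k H.
have e0 : counitL (tassoc (tmap (Delta H) id (Rmx H))) = Rmx H.
  move: (Rmx H); apply: tens_ext => [||a b]; [by lin | by lin |].
  by rewrite tmap_tens // counitL_tassoc counitL_Delta.
have e1 : counitL (leg_312 (Phi H)) = 1.
  have -> : counitL (leg_312 (Phi H)) = tflip (tmap id (@counitL _ H _) (Phi H)).
    move: (Phi H); apply: tens3_ext => [||a b c]; [by lin | by lin |].
    rewrite leg_312_tens counitL_tens tmap_tens //; last by lin.
    by rewrite tflip_tens counitL_tens tensZl.
  by rewrite mid_counit_Phi; case: (alg_morphism_tflip H).
have e2 r : counitL (leg_13 r) = 1 ⊗ counitL r.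
  move: r; apply: tens_ext => [||a b].
  - by lin.
  - by lin.
  rewrite leg_13E tmap_tens //; last by lin.
  by rewrite !counitL_tens tensZr.
have e3 : counitL (leg_132 (PhiV H)) = 1.
  have -> : counitL (leg_132 (PhiV H)) = tflip (counitL (PhiV H)).
    move: (PhiV H); apply: tens3_ext => [||a b c]; [by lin | by lin |].
    by rewrite leg_132_tens !counitL_tens (linZ (@tflip_linear _ _)) tflip_tens.
  rewrite (alg_morphism_inv (alg_morphism_counitL H _) (mulPhiV H)) //.
    by case: (alg_morphism_tflip H).
  exact: first_counit_Phi.
have e4 r : counitL (leg_23 r) = r.
  by rewrite leg_23E counitL_tens rmorph1 scale1r.
have := congr1 (@counitL _ _ _) (Delta_id_R H).
rewrite !cM e0 e1 e2 e3 e4 first_counit_Phi mul1r !mulr1.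
move/(congr1 (fun t => t * RmxV H)).
rewrite -mulrA mulRV mulr1 => /(congr1 (@counitL _ _ _)).
by rewrite tens1E !counitL_tens rmorph1 !scale1r.
Qed.

(** The same with [ε] on leg 3 of the second hexagon. *)
Lemma counitR_R : counitR (Rmx H) = 1.
Proof.
have [_ _ cM] := alg_morphism_last_counit H.
have Dl := @Delta_linear k H.
have PhiV1 := alg_morphism_inv (alg_morphism_last_counit H) (mulPhiV H)
  (@last_counit_Phi _ _).
have e0 : tmap id (@counitR _ H _) (tmap id (Delta H) (Rmx H)) = Rmx H.
  move: (Rmx H); apply: tens_ext => [||a b]; [by lin | by lin |].
  by rewrite !tmap_tens ?counitR_Delta //; lin.
have e1 : tmap id (@counitR _ H _) (leg_231 (PhiV H)) = 1.
  have -> : tmap id (@counitR _ H _) (leg_231 (PhiV H))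
      = tflip (tmap id (@counitL _ H _) (PhiV H)).
    move: (PhiV H); apply: tens3_ext => [||a b c]; [by lin | by lin |].
    rewrite leg_231_tens !tmap_tens //; [| by lin ..].
    by rewrite tflip_tens counitL_tens counitR_tens tensZl tensZr.
  rewrite (alg_morphism_inv (alg_morphism_mid_counit H) (mulPhiV H)) //.
    by case: (alg_morphism_tflip H).
  exact: mid_counit_Phi.
have e2 r : tmap id (@counitR _ H _) (leg_13 r) = counitR r ⊗ 1.
  move: r; apply: tens_ext => [||a b].
  - by lin.
  - by lin.
  rewrite leg_13E !tmap_tens //; [| by lin ..].
  by rewrite !counitR_tens tensZl tensZr.
have e3 : tmap id (@counitR _ H _) (leg_213 (Phi H)) = 1.
  have -> : tmap id (@counitR _ H _) (leg_213 (Phi H))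
      = tflip (tmap id (@counitR _ H _) (Phi H)).
    move: (Phi H); apply: tens3_ext => [||a b c]; [by lin | by lin |].
    rewrite leg_213_tens !tmap_tens //; [| by lin ..].
    by rewrite tflip_tens !counitR_tens tensZl tensZr.
  by rewrite last_counit_Phi; case: (alg_morphism_tflip H).
have e4 r : tmap id (@counitR _ H _) (leg_12 r) = r.
  rewrite leg_12E; move: r; apply: tens_ext => [||a b]; [by lin | by lin |].
  rewrite tassoc_tens tmap_tens //; last by lin.
  by rewrite counitR_tens rmorph1 scale1r.
have := congr1 (tmap id (@counitR _ _ _)) (id_Delta_R H).
rewrite !cM e0 e1 e2 e3 e4 PhiV1 mul1r !mulr1.
move/(congr1 (fun t => t * RmxV H)).
rewrite -mulrA mulRV mulr1 => /(congr1 (@counitR _ _ _)).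
by rewrite tens1E !counitR_tens rmorph1 !scale1r.
Qed.

(** [R_12] conjugates [Δ ⊗ I] into [Δ^cop ⊗ I], which is [Δ ⊗ I] followed by the
exchange of legs 1 and 2. That exchange takes the right side of the first
hexagon to [Φ_321 R_23 Φ_231^-1 R_13 Φ_213]; with [R_12] behind it, the last
four factors are the second hexagon without its final [Φ^-1]. *)
Lemma quasi_Yang_Baxter :
  leg_12 (Rmx H) * tassoc (tmap (Delta H) id (Rmx H)) =
  leg_321 (Phi H) * leg_23 (Rmx H) * tmap id (Delta H) (Rmx H) * Phi H.
Proof.
have Dl := @Delta_linear k H.
have [_ _ tM] := alg_morphism_tassoc H H H.
have [_ _ sM] := alg_morphism_leg_213 H.
(* For [s = a ⊗ b] this is [R Δ(a) = Δ^cop(a) R]. *)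
have swap s : leg_12 (Rmx H) * tassoc (tmap (Delta H) id s)
    = leg_213 (tassoc (tmap (Delta H) id s)) * leg_12 (Rmx H).
  rewrite leg_12E; move: s; apply: tens_ext => [||a b]; [by lin | by lin |].
  rewrite tmap_tens // leg_213_tassoc Delta_cop -!tM !tensM mulr1 mul1r.
  by rewrite -!mulrA mulVR mulr1.
rewrite swap Delta_id_R id_Delta_R !sM leg_213_312 leg_213_13 leg_213_132.
by rewrite leg_213_23 -!mulrA mulVPhi mulr1.
Qed.

End RMatrix.

(** * Pairing functionals with tensors *)

Section DualTensor.
Variables (k : fieldType) (V W : lmodType k).

Lemma dual_tens_bilin (f : dual V) (g : dual W) :
  bilin (fun v w => f v * g w : k^o).
Proof.
split=> [w|v] a x y; first by rewrite linearP mulrDl -mulrA.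
by rewrite linearP mulrDr; congr (_ + _); apply: mulrCA.
Qed.

Lemma dual_tens_scalar (f : dual V) (g : dual W) :
  scalar (fun t : V ⊗ W => \tsum_(v ⊗ w <- t) (f v * g w : k^o) : k).
Proof. exact: tlift_linear (dual_tens_bilin f g). Qed.

Definition dual_tens (f : dual V) (g : dual W) : dual (V ⊗ W)%type :=
  mkdual (dual_tens_scalar f g).

Lemma dual_tensE f g v w : dual_tens f g (v ⊗ w) = f v * g w.
Proof. exact: (tlift_tens v w (dual_tens_bilin f g)). Qed.

End DualTensor.

Lemma dual_tens_assoc (k : fieldType) (U V W : lmodType k)
    (f : dual U) (g : dual V) (l : dual W) t :
  dual_tens f (dual_tens g l) (tassoc t) = dual_tens (dual_tens f g) l t.
Proof.
move: t; apply: (tens_ext (W := k^o)) => [||s w]; [by lin | by lin |].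
move: s; apply: (tens_ext (W := k^o)) => [||u v]; [by lin | by lin |].
by rewrite tassoc_tens !dual_tensE mulrA.
Qed.

Lemma dual_tliftE (k : fieldType) (U V W : lmodType k) (F : U -> V -> dual W)
    (t : U ⊗ V) x :
  tlift F t x = \tsum_(u ⊗ v <- t) (F u v x : k^o).
Proof. exact: dual_sumE. Qed.

Lemma dual_tlift3E (k : fieldType) (U V W X : lmodType k)
    (F : U -> V -> W -> dual X) (t : U ⊗ V ⊗ W) x :
  (\tsum_(u ⊗ v ⊗ w <- t) F u v w) x =
  \tsum_(u ⊗ v ⊗ w <- t) (F u v w x : k^o).
Proof.
rewrite dual_tliftE.
have := @eq_tlift _ _ _ _ (fun u s => tlift (F u) s x : k^o)
  (fun u => tlift (fun v w => F u v w x : k^o)).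
by apply=> u s; rewrite dual_tliftE.
Qed.

(** * The product of the dual *)

Section Product.
Variables (k : fieldType) (H : quasitriangular k).
Implicit Types (f g l : dual H).

(** The definition of the product pairs [f ⊗ g] with [Δ^cop(x) R], which is
[R Δ(x)] by quasi-cocommutativity. *)
Lemma mulR_dual_tens f g (x : H) :
  (f · g) x = dual_tens f g (Rmx H * Delta H x).
Proof.
rewrite mulRE -[Rmx H * _]mulr1 -(mulVR H) mulrA -Delta_cop.
apply: (tlift_eq (G := fun p => dual_tens f g (tflip p * Rmx H) : k^o)).
  by lin.
move=> a b.
apply: (tlift_eq (G := fun r => dual_tens f g (tflip (a ⊗ b) * r) : k^o)).
  by lin.
by move=> r1 r2; rewrite tflip_tens tensM dual_tensE mulrC.
Qed.

Lemma dual_tens_act f g (a a' b b' : H) s :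
  dual_tens (a ⇀ f ↼ a') (b ⇀ g ↼ b') s =
  dual_tens f g ((a' ⊗ b') * s * (a ⊗ b)).
Proof.
move: s; apply: (tens_ext (W := k^o)) => [||x y]; [by lin | by lin |].
by rewrite !tensM !dual_tensE.
Qed.

Lemma mulR_act f g (a a' b b' x : H) :
  ((a ⇀ f ↼ a') · (b ⇀ g ↼ b')) x =
  dual_tens f g ((a' ⊗ b') * (Rmx H * Delta H x) * (a ⊗ b)).
Proof. by rewrite mulR_dual_tens dual_tens_act. Qed.

(** At [x], both sides pair [f ⊗ g] with [Δ^cop(h') T(x) Δ(h)]. *)
Lemma mulR_bimodule f g (h h' : H) :
  h ⇀ (f · g) ↼ h' =
  \tsum_(h1 ⊗ h2 <- Delta H h) \tsum_(h'1 ⊗ h'2 <- Delta H h')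
    (h1 ⇀ f ↼ h'2) · (h2 ⇀ g ↼ h'1).
Proof.
apply: dual_ext => x; rewrite dual_tliftE; apply/esym.
have -> : (h ⇀ (f · g) ↼ h') x = (f · g) (h' * x * h) by [].
pose T := Rmx H * Delta H x.
have -> : (f · g) (h' * x * h)
    = dual_tens f g (tflip (Delta H h') * T * Delta H h).
  rewrite mulR_dual_tens !rmorphM Delta_cop; congr (dual_tens f g _).
  by rewrite /T !mulrA -[_ * RmxV H * _]mulrA mulVR mulr1.
apply: (tlift_eq
  (G := fun p => dual_tens f g (tflip (Delta H h') * T * p) : k^o)).
  by lin.
move=> h1 h2; rewrite dual_tliftE.
apply: (tlift_eq
  (G := fun q => dual_tens f g (tflip q * T * (h1 ⊗ h2)) : k^o)).
  by lin.
by move=> q1 q2; rewrite mulR_act tflip_tens.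
Qed.

(** At [x], the right side pairs [g ⊗ f] with [R^-1 T(x)] multiplied by the flip
of [R]. Exchanging [f] and [g] flips the tensor, and
[flip(R^-1 T(x)) R = Δ^cop(x) R]. *)
Lemma mulR_quantum_commutative f g :
  f · g =
  \tsum_(r1 ⊗ r2 <- Rmx H) \tsum_(u1 ⊗ u2 <- RmxV H)
    (r2 ⇀ g ↼ u1) · (r1 ⇀ f ↼ u2).
Proof.
apply: dual_ext => x; rewrite dual_tliftE; apply/esym.
pose T := Rmx H * Delta H x.
have dual_tens_flip s : dual_tens g f s = dual_tens f g (tflip s).
  move: s; apply: (tens_ext (W := k^o)) => [||a b]; [by lin | by lin |].
  by rewrite tflip_tens !dual_tensE mulrC.
have fM : {morph @tflip k H : s t / s * t} by case: (alg_morphism_tflip H).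
have -> : (f · g) x = dual_tens f g (tflip (RmxV H * T) * Rmx H).
  rewrite mulR_dual_tens /T mulrA mulVR mul1r Delta_cop.
  by rewrite -[_ * RmxV H * _]mulrA mulVR mulr1.
apply: (tlift_eq
  (G := fun r => dual_tens f g (tflip (RmxV H * T) * r) : k^o)).
  by lin.
move=> r1 r2; rewrite dual_tliftE.
apply: (tlift_eq
  (G := fun u => dual_tens f g (tflip (u * T) * (r1 ⊗ r2)) : k^o)).
  by lin.
move=> u1 u2; rewrite mulR_act dual_tens_flip !fM.
by rewrite (tflip_tens r2 r1).
Qed.

Lemma counit_act (h h' : H) :
  h ⇀ dual_counit H ↼ h' = (counit H h * counit H h') *: dual_counit H.
Proof.
by apply: dual_ext => x /=; rewrite !rmorphM /= mulrC mulrA.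
Qed.

Lemma mulR_counit f : dual_counit H · f = f /\ f · dual_counit H = f.
Proof.
have [_ _ c1M] := alg_morphism_counitL H H.
have [_ _ c2M] := alg_morphism_counitR H H.
split; apply: dual_ext => x; rewrite mulR_dual_tens.
  have -> s : dual_tens (dual_counit H) f s = f (counitL s).
    move: s; apply: (tens_ext (W := k^o)) => [||a b]; [by lin | by lin |].
    by rewrite dual_tensE counitL_tens linearZ.
  by rewrite c1M counitL_R counitL_Delta mul1r.
have -> s : dual_tens f (dual_counit H) s = f (counitR s).
  move: s; apply: (tens_ext (W := k^o)) => [||a b]; [by lin | by lin |].
  by rewrite dual_tensE counitR_tens linearZ mulrC.
by rewrite c2M counitR_R counitR_Delta mul1r.
Qed.

(** This lemma and [dual_tens_mulRr] express the two bracketings of a triple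
product through one and the same pairing on [H ⊗ (H ⊗ H)]. *)
Lemma dual_tens_mulRl f g l s :
  dual_tens (f · g) l s =
  dual_tens f (dual_tens g l) (leg_12 (Rmx H) * tassoc (tmap (Delta H) id s)).
Proof.
have [_ _ tM] := alg_morphism_tassoc H H H.
have Dl := @Delta_linear k H.
move: s; apply: (tens_ext (W := k^o)) => [||a b]; [by lin | by lin |].
rewrite dual_tensE mulR_dual_tens tmap_tens // leg_12E -tM tensM mul1r.
by rewrite dual_tens_assoc dual_tensE.
Qed.

Lemma dual_tens_mulRr f g l s :
  dual_tens f (g · l) s =
  dual_tens f (dual_tens g l) (leg_23 (Rmx H) * tmap id (Delta H) s).
Proof.
have Dl := @Delta_linear k H.
move: s; apply: (tens_ext (W := k^o)) => [||a b]; [by lin | by lin |].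
rewrite dual_tensE mulR_dual_tens tmap_tens // leg_23E tensM mul1r.
by rewrite dual_tensE.
Qed.

Lemma dual_tens3_act f g l (a a' b b' c c' : H) s :
  dual_tens (a ⇀ f ↼ a') (dual_tens (b ⇀ g ↼ b') (c ⇀ l ↼ c')) s =
  dual_tens f (dual_tens g l) ((a' ⊗ b' ⊗ c') * s * (a ⊗ b ⊗ c)).
Proof.
move: s; apply: (tens3_ext (X := k^o)) => [||x y z]; [by lin | by lin |].
by rewrite !tensM !dual_tensE.
Qed.

Lemma mulRA f g l :
  (f · g) · l =
  \tsum_(x1 ⊗ x2 ⊗ x3 <- Phi H) \tsum_(y1 ⊗ y2 ⊗ y3 <- Phi H)
    (x1 ⇀ f ↼ y3) · ((x2 ⇀ g ↼ y2) · (x3 ⇀ l ↼ y1)).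
Proof.
have [_ _ tM] := alg_morphism_tassoc H H H.
have [_ _ DM] := alg_morphism_tmap (alg_morphism_Delta H) (alg_morphism_id H).
have [_ _ MD] := alg_morphism_tmap (alg_morphism_id H) (alg_morphism_Delta H).
apply: dual_ext => x.
pose T := leg_23 (Rmx H) * tmap id (Delta H) (Rmx H * Delta H x).
have -> : ((f · g) · l) x =
    dual_tens f (dual_tens g l) (leg_321 (Phi H) * T * Phi H).
  rewrite mulR_dual_tens dual_tens_mulRl; congr (dual_tens _ _ _).
  (* Quasi-coassociativity: [(I ⊗ Δ)(Δ x) Φ = Φ (Δ ⊗ I)(Δ x)]. *)
  rewrite DM tM mulrA quasi_Yang_Baxter /T MD quasi_coassoc -!mulrA.
  by rewrite mulVPhi mulr1.
apply/esym; rewrite dual_tlift3E.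
apply: (tlift3_eq
  (G := fun p => dual_tens f (dual_tens g l) (leg_321 (Phi H) * T * p) : k^o)).
  by lin.
move=> x1 x2 x3; rewrite dual_tlift3E.
apply: (tlift3_eq (G := fun q => dual_tens f (dual_tens g l)
  (leg_321 q * T * (x1 ⊗ x2 ⊗ x3)) : k^o)).
  by lin.
move=> y1 y2 y3.
by rewrite mulR_dual_tens dual_tens_mulRr dual_tens3_act leg_321_tens.
Qed.

End Product.

(** * The category of bimodules *)

Section BimoduleTensor.
Variables (k : fieldType) (H : quasiBialgebra k).
Implicit Types U V W : bimodType H.

Lemma lact_linear V (h : H) : linear (lact h : V -> V).
Proof. exact: lact_bilin.2. Qed.

Lemma ract_linear V (h : H) : linear (fun v : V => v ↼ h).
Proof. exact: ract_bilin.1. Qed.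

Lemma act_linear V (h h' : H) : linear (fun v : V => h ⇀ v ↼ h').
Proof. by move=> a x y; rewrite lact_linear ract_linear. Qed.

Lemma tens_act V W (h h' : H) (v : V) (w : W) :
  h ⇀ (v ⊗ w : V ⊗ W) ↼ h' =
  \tsum_(h1 ⊗ h2 <- Delta H h) \tsum_(q1 ⊗ q2 <- Delta H h')
    (h1 ⇀ v ↼ q2) ⊗ (h2 ⇀ w ↼ q1).
Proof.
have ll := lact_linear; have rl := ract_linear.
rewrite /lact /= /tens_lact (linear_tlift _ _ (rl _ h')).
apply: eq_tlift => h1 h2; rewrite tmap_tens; [| exact: ll | exact: ll].
rewrite /ract /= /tens_ract; apply: eq_tlift => q1 q2.
by rewrite tmap_tens; [| exact: rl | exact: rl].
Qed.

Lemma Hlr_assoc_tens U V W (u : U) (v : V) (w : W) :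
  Hlr_assoc ((u ⊗ v) ⊗ w) =
  \tsum_(x1 ⊗ x2 ⊗ x3 <- Phi H) \tsum_(y1 ⊗ y2 ⊗ y3 <- Phi H)
    (x1 ⇀ u ↼ y3) ⊗ (x2 ⇀ v ↼ y2) ⊗ (x3 ⇀ w ↼ y1).
Proof.
have al := act_linear.
apply: eq_tlift => x1 s; apply: eq_tlift => x2 x3.
apply: eq_tlift => y1 s'; apply: eq_tlift => y2 y3.
rewrite tassoc_tens tmap_tens; last by apply: tmap_linear; apply: al.
  by rewrite tmap_tens; [| exact: al | exact: al].
exact: al.
Qed.

Lemma Hlr_assoc_linear U V W :
  linear (@Hlr_assoc k H U V W).
Proof.
apply: tlift_param => x1 s; apply: tlift_param => x2 x3.
apply: tlift_param => y1 s'; apply: tlift_param => y2 y3.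
apply: comp_linear; last exact: tassoc_linear.
by do 2 (apply: tmap_linear; first exact: act_linear); exact: act_linear.
Qed.

End BimoduleTensor.

Section BraidingTheory.
Variables (k : fieldType) (H : quasitriangular k) (V W : bimodType H).

Lemma Hlr_braiding_bilin :
  bilin (fun (v : V) (w : W) =>
    \tsum_(r1 ⊗ r2 <- Rmx H) \tsum_(u1 ⊗ u2 <- RmxV H)
      (r2 ⇀ w ↼ u1) ⊗ (r1 ⇀ v ↼ u2)).
Proof.
split=> [w|v]; apply: tlift_param => r1 r2;
  apply: tlift_param => u1 u2 a x y.
- by rewrite act_linear tensDr tensZr.
- by rewrite act_linear tensDl tensZl.
Qed.

Lemma Hlr_braiding_linear : linear (@Hlr_braiding k H V W).
Proof. exact: tlift_linear Hlr_braiding_bilin. Qed.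

Lemma Hlr_braiding_tens (v : V) (w : W) :
  Hlr_braiding (v ⊗ w) =
  \tsum_(r1 ⊗ r2 <- Rmx H) \tsum_(u1 ⊗ u2 <- RmxV H)
    (r2 ⇀ w ↼ u1) ⊗ (r1 ⇀ v ↼ u2).
Proof. exact: tlift_tens Hlr_braiding_bilin. Qed.

End BraidingTheory.

Section MulMap.
Variables (k : fieldType) (H : quasitriangular k).
Implicit Types (f g l : dual H).

Lemma mulR_map_linear : linear (@mulR_map k H).
Proof. exact: tlift_linear (@mulR_bilin k H). Qed.

Lemma mulR_map_tens f g : mulR_map (f ⊗ g) = f · g.
Proof. exact: tlift_tens (@mulR_bilin k H). Qed.

Lemma unitR_map_linear : linear (@unitR_map k H).
Proof. by move=> a x y; rewrite /unitR_map scalerDl scalerA. Qed.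

Lemma mulR_map_morphism : Hlr_morphism (@mulR_map k H).
Proof.
have ml := mulR_map_linear.
split=> // h t h'; move: t; apply: tens_ext => [||f g].
- exact: comp_linear ml (act_linear _ _).
- exact: comp_linear (act_linear _ _) ml.
rewrite tens_act mulR_map_tens mulR_bimodule linear_tlift //.
apply: eq_tlift => h1 h2; rewrite linear_tlift //; apply: eq_tlift => q1 q2.
exact: mulR_map_tens.
Qed.

Lemma unitR_map_morphism : Hlr_morphism (@unitR_map k H).
Proof.
split=> [|h c h']; first exact: unitR_map_linear.
rewrite /unitR_map (linZ (act_linear _ _)) counit_act scalerA; congr (_ *: _).
by rewrite /lact /ract /= /unit_ract /unit_lact mulrA; congr (_ * _); rewrite mulrC.
Qed.

Lemma mulR_mapA (t : (dual H ⊗ dual H) ⊗ dual H) :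
  mulR_map (tmap (@mulR_map k H) id t) =
  mulR_map (tmap id (@mulR_map k H) (Hlr_assoc t)).
Proof.
have ml := mulR_map_linear.
have tl : linear (tmap id (@mulR_map k H) :
    dual H ⊗ dual H ⊗ dual H -> dual H ⊗ dual H).
  by apply: tmap_linear => //; exact: ml.
have al := @Hlr_assoc_linear k H (dual H) (dual H) (dual H).
move: t; apply: tens_ext => [||s l]; [by lin | by lin |].
move: s; apply: tens_ext => [||f g]; [by lin | by lin |].
rewrite tmap_tens // !mulR_map_tens mulRA Hlr_assoc_tens.
rewrite (linear_tlift _ _ tl) (linear_tlift _ _ ml).
apply: eq_tlift => x1 s; rewrite (linear_tlift _ _ tl) (linear_tlift _ _ ml).
apply: eq_tlift => x2 x3; rewrite (linear_tlift _ _ tl) (linear_tlift _ _ ml).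
apply: eq_tlift => y1 s'; rewrite (linear_tlift _ _ tl) (linear_tlift _ _ ml).
by apply: eq_tlift => y2 y3; rewrite tmap_tens // !mulR_map_tens.
Qed.

Lemma mulR_map_algebra : Hlr_algebra (@mulR_map k H) (@unitR_map k H).
Proof.
have ml := mulR_map_linear; have ul := unitR_map_linear.
split; [exact: mulR_map_morphism | exact: unitR_map_morphism
       | exact: mulR_mapA | |].
- apply: tens_ext => [||c f].
  + exact: comp_linear ml (tmap_linear ul _).
  + exact: tlift_linear (scale_bilin _).
  + rewrite tmap_tens // mulR_map_tens /Hlr_lunit tlift_tens.
      by rewrite /unitR_map (linZ ((@mulR_bilin k H).1 f)) (mulR_counit f).1.
    exact: scale_bilin.
- apply: tens_ext => [||f c].
  + exact: comp_linear ml (tmap_linear _ ul).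
  + exact: tlift_linear (scaler_bilin _).
  + rewrite tmap_tens // mulR_map_tens /Hlr_runit tlift_tens.
      by rewrite /unitR_map (linZ ((@mulR_bilin k H).2 f)) (mulR_counit f).2.
    exact: scaler_bilin.
Qed.

Lemma mulR_map_quantum_commutative : quantum_commutative (@mulR_map k H).
Proof.
have ml := mulR_map_linear.
apply: tens_ext => [||f g].
- exact: comp_linear ml (@Hlr_braiding_linear _ _ _ _).
- exact: ml.
rewrite Hlr_braiding_tens mulR_map_tens [RHS]mulR_quantum_commutative.
rewrite linear_tlift //; apply: eq_tlift => r1 r2.
rewrite linear_tlift //; apply: eq_tlift => u1 u2.
exact: mulR_map_tens.
Qed.

End MulMap.

Theorem theorem3p1 (k : fieldType) (H : quasitriangular k) :
  (Hlr_algebra (@mulR_map k H) (@unitR_map k H) /\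
   [/\ forall (f g : dual H) (h h' : H),
         h ⇀ (f · g) ↼ h' =
         \tsum_(h1 ⊗ h2 <- Delta H h) \tsum_(h'1 ⊗ h'2 <- Delta H h')
           (h1 ⇀ f ↼ h'2) · (h2 ⇀ g ↼ h'1),
       forall f g l : dual H,
         (f · g) · l =
         \tsum_(x1 ⊗ x2 ⊗ x3 <- Phi H) \tsum_(y1 ⊗ y2 ⊗ y3 <- Phi H)
           (x1 ⇀ f ↼ y3) · ((x2 ⇀ g ↼ y2) · (x3 ⇀ l ↼ y1)),
       forall f : dual H, dual_counit H · f = f /\ f · dual_counit H = f &
       forall h h' : H,
         h ⇀ dual_counit H ↼ h' = (counit H h * counit H h') *: dual_counit H]) /\
  (quantum_commutative (@mulR_map k H) /\
   forall f g : dual H,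
     f · g =
     \tsum_(r1 ⊗ r2 <- Rmx H) \tsum_(u1 ⊗ u2 <- RmxV H)
       (r2 ⇀ g ↼ u1) · (r1 ⇀ f ↼ u2)).
Proof.
split; split.
- exact: mulR_map_algebra.
- split; [exact: mulR_bimodule | exact: mulRA | exact: mulR_counit
         | exact: counit_act].
- exact: mulR_map_quantum_commutative.
- exact: mulR_quantum_commutative.
Qed.
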